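(* Let $V=\mathbb R^{2m+1}=\mathbb R^{2m+1,0}$ and let $S=S_{2m+1,0}$ be its spinor module in the model of the context, with form $h$ and operators $I,J,K$ as there; write $j_A=j_\rho(h_A)$, $h_A=h(A\cdot,\cdot)$. If $m\equiv3\pmod4$, every $\mathfrak{so}(2m+1)$-equivariant embedding $\mathbb R^{2m+1}\hookrightarrow S^*\otimes S^*$ is a multiple of $j_\rho(h):\mathbb R^{2m+1}\hookrightarrow\wedge^2S^*$. If $m\not\equiv3\pmod4$, every $\mathfrak{so}(2m+1)$-equivariant embedding $\mathbb R^{2m+1}\hookrightarrow(S\otimes S)^*$ is a linear combination of the embeddings $j_A$, $A=\mathrm{Id},I,J,K$, whose images are contained in the dual of the following subspaces depending on $m\pmod4$: - $m\equiv1$: $j_{Id}$: $\wedge^2S$; $j_I,j_J,j_K$: $\vee^2S$. - $m\equiv2$: $j_{Id},j_J,j_K$: $\wedge^2S$; $j_I$: $\vee^2S$. - $m\equiv4$: $j_{Id}$: $S^+\wedge S^-$; $j_I$: $\vee^2S^++\vee^2S^-$; $j_J$: $S^+\vee S^-$; $j_K$: $\vee^2S^++\vee^2S^-$.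
   Context: $C\ell_m=C\ell_{m,0}$ is the Clifford algebra of Euclidean $\mathbb R^m$ with $v^2=-\langle v,v\rangle$; $\mathbb C\ell_m=C\ell_m\otimes\mathbb C$; $\alpha$ is $+1$ on the even, $-1$ on the odd part; $\omega=\omega_m=e_1\cdots e_m$ is the volume element; $L_\omega$ is left multiplication; $c$ is complex conjugation on $\mathbb C\ell_m$ with respect to $C\ell_m$; $I$ is multiplication by $i$ on $\mathbb C\ell_m$. Decompose $\mathbb R^{2m}=\mathbb R^m+\widetilde{\mathbb R^m}$ orthogonally with an isometry $x\mapsto\tilde x$. An irreducible representation $\rho$ of $C\ell_{2m}$ on $S_{2m,0}$ is: $\rho(x)s=xs$ in all cases, and $\rho(\tilde x)s=\omega sx$ on $S_{2m,0}=C\ell_m$ if $m\equiv0$; $\rho(\tilde x)s=\omega\alpha(s)x$ on $S_{2m,0}=C\ell_m$ if $m\equiv3$; $\rho(\tilde x)s=i\alpha(s)x$ on $S_{2m,0}=\mathbb C\ell_m$ if $m\equiv1,2$ (mod 4). Let $\mathbb R^{2m+1}=\mathbb Re_0+\mathbb R^{2m}$ with $e_0$ a unit vector. $S=S_{2m+1,0}=S_{2m,0}$ if $m\equiv1,2,3$ and $S=S_{2m,0}\otimes\mathbb C=\mathbb C\ell_m$ (with $\rho$ extended complex linearly) if $m\equiv0\pmod4$; $S$ is regarded as a real module. The irreducible representation $\tilde\rho$ of $C\ell_{2m+1}$ on $S$ is $\tilde\rho=\rho$ on $\mathbb R^{2m}$, $\tilde\rho(e_0)=\rho(\omega_{2m})$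 if $m\equiv1,3$ and $\tilde\rho(e_0)=I\circ\rho(\omega_{2m})$ if $m\equiv0,2\pmod 4$, where $\omega_{2m}$ is the volume element of $C\ell_{2m}$. If $m\equiv0\pmod4$, $S^+=C\ell^0_m+iC\ell^1_m$ and $S^-=iS^+$; otherwise $S$ is irreducible over $\mathfrak{so}(2m+1)$. $h$ is the positive definite scalar product on $S$ invariant under $\tilde\rho(v)$, $v$ unit (unique up to scale). $J=L_\omega\circ c$ if $m\equiv1,2$; $J=\alpha\circ c$ if $m\equiv0\pmod4$; $K=IJ$. $j_\rho(\beta)(v)=\beta(\tilde\rho(v)\cdot,\cdot)$ (Clifford multiplication on $S$). Image in the dual of $\wedge^2S$ (resp. $\vee^2S$) means all forms $j(v)$ are skew symmetric (resp. symmetric); $\vee^2S^++\vee^2S^-$: symmetric with $S^+\perp S^-$; $S^+\vee S^-$ (resp. $S^+\wedge S^-$): symmetric (resp. skew symmetric) with $S^\pm$ isotropic. *)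

(* Defs.v *)
From HB Require Import structures.
From mathcomp Require Import all_boot all_order all_algebra.
From mathcomp Require Import complex.

Set Implicit Arguments.
Unset Strict Implicit.
Unset Printing Implicit Defensive.

Import Order.TTheory GRing.Theory Num.Theory.
Local Open Scope ring_scope.

(* [clifford A m] is Cl_m (x)_R A, where Cl_m is the Clifford algebra of the
   Euclidean space R^m with v^2 = - <v, v>: the family (s B), for B a subset of
   {0, .., m-1}, holds the coefficients of s in the basis
     e_B = e_{b_1} * .. * e_{b_k},  B = {b_1 < .. < b_k}.
   Thus Cl_m is [clifford R^o m], and its complexification, seen as a real
   algebra, is [clifford (Rcomplex R) m]. *)
Section CliffordAlgebra.
Variables (R : comNzRingType) (A : comAlgType R) (m : nat).
Implicit Types B C D : {set 'I_m}.

Record clifford := Clifford { coef :> {ffun {set 'I_m} -> A} }.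

HB.instance Definition _ := [isNew for coef].
HB.instance Definition _ := [Choice of clifford by <:].

Implicit Types s t u : clifford.

Let cliffordP s t : s =1 t -> s = t.
Proof. by move=> st; apply/val_inj/ffunP. Qed.

Let clifford_zero := Clifford 0.
Let clifford_opp s := Clifford (- coef s).
Let clifford_add s t := Clifford (coef s + coef t).

Let clifford_addA : associative clifford_add.
Proof. by move=> s t u; apply: val_inj; apply: addrA. Qed.
Let clifford_addC : commutative clifford_add.
Proof. by move=> s t; apply: val_inj; apply: addrC. Qed.
Let clifford_add0 : left_id clifford_zero clifford_add.
Proof. by move=> s; apply: val_inj; apply: add0r. Qed.
Let clifford_addN : left_inverse clifford_zero clifford_opp clifford_add.
Proof. by move=> s; apply: val_inj; apply: addNr. Qed.
HB.instance Definition _ := GRing.isZmodule.Build clifford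
  clifford_addA clifford_addC clifford_add0 clifford_addN.

Let clifford_scale (a : R) s := Clifford (a *: coef s).

Let clifford_scaleA a b s :
  clifford_scale a (clifford_scale b s) = clifford_scale (a * b) s.
Proof. by apply: val_inj; apply: scalerA. Qed.
Let clifford_scale1 : left_id 1 clifford_scale.
Proof. by move=> s; apply: val_inj; apply: scale1r. Qed.
Let clifford_scaleDr : right_distributive clifford_scale +%R.
Proof. by move=> a s t; apply: val_inj; apply: scalerDr. Qed.
Let clifford_scaleDl s : {morph clifford_scale^~ s : a b / a + b}.
Proof. by move=> a b; apply: val_inj; apply: scalerDl. Qed.
HB.instance Definition _ := GRing.Zmodule_isLmodule.Build R clifford
  clifford_scaleA clifford_scale1 clifford_scaleDr clifford_scaleDl.

Lemma coefD s t B : (s + t) B = s B + t B. Proof. exact: ffunE. Qed.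
Lemma coefZ (a : R) s B : (a *: s) B = a *: s B. Proof. exact: ffunE. Qed.

Definition symdiff B C := [set i | (i \in B) (+) (i \in C)].

(* e_B * e_C = (-1) ^ (inversions B C) * e_(B symdiff C): one sign for each
   exchange e_i e_j = - e_j e_i (j < i), one for each square e_i^2 = -1. *)
Definition inversions B C : nat :=
  (\sum_(i in B) \sum_(j in C) (j <= i))%N.

Definition clifford_mul s t : clifford :=
  Clifford [ffun D => \sum_B
    (-1) ^+ inversions B (symdiff B D) * (s B * t (symdiff B D))].

Definition blade B : clifford := Clifford [ffun D => (D == B)%:R].

Let symdiff0s B : symdiff set0 B = B.
Proof. by apply/setP=> i; rewrite !inE. Qed.
Let symdiffC B C : symdiff B C = symdiff C B.
Proof. by apply/setP=> i; rewrite !inE addbC. Qed.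
Let symdiffA B C D : symdiff B (symdiff C D) = symdiff (symdiff B C) D.
Proof. by apply/setP=> i; rewrite !inE addbA. Qed.
Let symdiffK B : cancel (symdiff B) (symdiff B).
Proof. by move=> C; apply/setP=> i; rewrite !inE addbA addbb. Qed.
Let symdiffss B : symdiff B B = set0.
Proof. by apply/setP=> i; rewrite !inE addbb. Qed.

Let inv_odd B C : odd (inversions B C) =
  \big[addb/false]_(i in B) \big[addb/false]_(j in C) (j <= i)%N.
Proof.
rewrite /inversions (big_morph _ oddD (erefl : odd 0 = false)).
apply: eq_bigr => i _.
rewrite (big_morph _ oddD (erefl : odd 0 = false)).
by apply: eq_bigr => j _; rewrite oddb.
Qed.

Let big_symdiff (F : 'I_m -> bool) B C :
  \big[addb/false]_(i in symdiff B C) F i =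
  \big[addb/false]_(i in B) F i (+) \big[addb/false]_(i in C) F i.
Proof.
rewrite big_mkcond [in RHS]big_mkcond [X in _ (+) X]big_mkcond -big_split /=.
by apply: eq_bigr => i _; rewrite inE; case: (i \in B); case: (i \in C);
  rewrite /= ?addbb ?addbF.
Qed.

Let inv_symdiffl B C D :
  odd (inversions (symdiff B C) D) = odd (inversions B D) (+) odd (inversions C D).
Proof. by rewrite !inv_odd big_symdiff. Qed.

Let inv_symdiffr B C D :
  odd (inversions B (symdiff C D)) = odd (inversions B C) (+) odd (inversions B D).
Proof.
by rewrite !inv_odd -big_split; apply: eq_bigr => i _; rewrite big_symdiff.
Qed.

Let clifford_mulDl : left_distributive clifford_mul +%R.
Proof.
move=> s t u; apply: cliffordP => D; rewrite coefD !ffunE -big_split.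
by apply: eq_bigr => B _; rewrite coefD mulrDl mulrDr.
Qed.

Let clifford_mulDr : right_distributive clifford_mul +%R.
Proof.
move=> s t u; apply: cliffordP => D; rewrite coefD !ffunE -big_split.
by apply: eq_bigr => B _; rewrite coefD !mulrDr.
Qed.

Let clifford_mulA : associative clifford_mul.
Proof.
move=> s t u; apply: cliffordP => D; rewrite !ffunE.
under eq_bigr => B _ do rewrite ffunE !mulr_sumr.
under [RHS]eq_bigr => B _ do rewrite ffunE mulr_suml mulr_sumr.
rewrite [RHS]exchange_big; apply: eq_bigr => B _ /=.
rewrite [RHS](reindex_inj (can_inj (symdiffK B))); apply: eq_bigr => C _ /=.
rewrite symdiffK [symdiff B C]symdiffC -symdiffA -!mulrA.
rewrite [X in _ * X = _]mulrCA [LHS]mulrA [RHS]mulrA -!exprD; congr (_ * _).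
rewrite -[LHS]signr_odd -[RHS]signr_odd; congr (_ ^+ nat_of_bool _).
rewrite !oddD !(inv_symdiffl, inv_symdiffr).
case: (odd (inversions B B)); case: (odd (inversions B C));
case: (odd (inversions B D)); case: (odd (inversions C B));
case: (odd (inversions C C)); by case: (odd (inversions C D)).
Qed.

Let clifford_mul1 : left_id (blade set0) clifford_mul.
Proof.
move=> s; apply: cliffordP => D; rewrite ffunE (bigD1 set0) //= big1 => [|B /negPf B0].
  by rewrite addr0 ffunE eqxx mul1r symdiff0s /inversions big_set0 mul1r.
by rewrite ffunE B0 mul0r mulr0.
Qed.

Let clifford_1mul : right_id (blade set0) clifford_mul.
Proof.
move=> s; apply: cliffordP => D; rewrite ffunE (bigD1 D) //= big1 => [|B /negPf BD].
  rewrite addr0 symdiffss ffunE eqxx mulr1 /inversions big1 ?mul1r // => i _.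
  by rewrite big_set0.
rewrite ffunE; case: eqP => [e|_]; last by rewrite !mulr0.
by rewrite -(symdiffK B D) e symdiffC symdiff0s eqxx in BD.
Qed.

Let clifford_1neq0 : blade set0 != 0.
Proof.
apply/eqP => /(congr1 (fun s : clifford => s set0)).
by rewrite !ffunE eqxx; apply/eqP/oner_neq0.
Qed.

HB.instance Definition _ := GRing.Zmodule_isNzRing.Build clifford
  clifford_mulA clifford_mul1 clifford_1mul clifford_mulDl clifford_mulDr
  clifford_1neq0.

Let clifford_scaleAl (a : R) (s t : clifford) : a *: (s * t) = (a *: s) * t.
Proof.
apply: cliffordP => D; rewrite coefZ !ffunE scaler_sumr; apply: eq_bigr => B _.
by rewrite coefZ scalerAr scalerAl.
Qed.
HB.instance Definition _ := GRing.Lmodule_isLalgebra.Build R clifford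
  clifford_scaleAl.

Let clifford_scaleAr (a : R) (s t : clifford) : a *: (s * t) = s * (a *: t).
Proof.
apply: cliffordP => D; rewrite coefZ !ffunE scaler_sumr; apply: eq_bigr => B _.
by rewrite coefZ !scalerAr.
Qed.
HB.instance Definition _ := GRing.Lalgebra_isAlgebra.Build R clifford
  clifford_scaleAr.

Definition gen (i : 'I_m) : clifford := blade [set i].

Definition vec (x : 'cV[R]_m) : clifford := \sum_i x i 0 *: gen i.

Definition omega : clifford := \prod_(i < m) gen i.

Definition alpha s : clifford := Clifford [ffun B : {set 'I_m} => (-1) ^+ #|B| * s B].

Lemma blade_mul B C :
  blade B * blade C = (-1) ^+ inversions B C *: blade (symdiff B C).
Proof.
apply: cliffordP => D; rewrite coefZ !ffunE (bigD1 B) //= big1 => [|B' /negPf BB'].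
  rewrite addr0 !ffunE eqxx mul1r.
  have -> : (symdiff B D == C) = (D == symdiff B C).
    by apply/eqP/eqP=> [<-|->]; rewrite symdiffK.
  case: eqP => [->|_]; last by rewrite mulr0 scaler0.
  by rewrite symdiffK mulr1 -signr_odd -[in RHS]signr_odd; case: (odd _);
    rewrite ?expr1 ?scaleN1r ?scale1r.
by rewrite ffunE BB' mul0r mulr0.
Qed.

Lemma blade_prod B : \prod_(i < m | i \in B) gen i = blade B.
Proof.
have lt_tr : transitive (fun i j : 'I_m => i < j)%N.
  by move=> i j k; apply: ltn_trans.
suff prodE (r : seq 'I_m) : sorted (fun i j : 'I_m => i < j)%N r ->
    \prod_(i <- r | i \in B) gen i = blade [set i in r | i \in B].
  have -> : index_enum _ = enum 'I_m by rewrite enumT [index_enum _]unlock.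
  rewrite prodE; last first.
    by have := iota_ltn_sorted 0 m; rewrite -val_enum_ord sorted_map.
  by congr blade; apply/setP=> i; rewrite !inE mem_enum.
elim: r => [|i r IHr] /=; first by move=> _; rewrite big_nil; congr blade.
move=> ir; rewrite big_cons IHr ?(path_sorted ir) //.
have /allP lt_ir := order_path_min lt_tr ir.
have [iB|iB] := ifPn; last first.
  congr blade; apply/setP=> j; rewrite !inE.
  by case: eqP => // ->; rewrite (negPf iB) !andbF.
rewrite blade_mul /inversions big_set1 big1 ?scale1r => [|j]; last first.
  by rewrite inE => /andP[/lt_ir]; rewrite ltnNge => /negPf->.
congr blade; apply/setP=> j; rewrite !inE; case: eqP => //= ->.
by rewrite iB; case: (boolP (i \in r)) => // /lt_ir; rewrite ltnn.
Qed.

Lemma omegaE : omega = blade setT.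
Proof.
by rewrite -blade_prod; apply: eq_bigl => i; rewrite inE.
Qed.

Lemma gen_anticomm i j : gen i * gen j + gen j * gen i = - (i == j)%:R *+ 2.
Proof.
rewrite !blade_mul /inversions !big_set1 symdiffC -scalerDl.
have [->|ij] := eqVneq i j.
  by rewrite leqnn symdiffss scalerDl scaleN1r.
have: (i : nat) != j by [].
by rewrite neq_ltn => /orP[] lt_ij; rewrite (ltnW lt_ij) leqNgt lt_ij /=
  ?(subrr, addNr) scale0r oppr0 mul0rn.
Qed.

Lemma vec_anticomm (x y : 'cV[R]_m) :
  vec x * vec y + vec y * vec x = - (2 * \sum_i x i 0 * y i 0)%:A.
Proof.
have vecM (u v : 'cV[R]_m) : vec u * vec v =
    \sum_i \sum_j (u i 0 * v j 0) *: (gen i * gen j).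
  rewrite /vec mulr_suml; apply: eq_bigr => i _.
  rewrite mulr_sumr; apply: eq_bigr => j _.
  by rewrite -scalerAl -scalerAr scalerA.
rewrite !vecM [X in _ + X]exchange_big -big_split mulr_sumr scaler_suml -sumrN.
apply: eq_bigr => i _; rewrite -big_split (bigD1 i) //= big1 => [|j ji].
  rewrite addr0 [y i 0 * _]mulrC -scalerDr gen_anticomm eqxx.
  by rewrite -mulNrn -scaler_nat scalerA scalerN mulrC mulr_natl.
by rewrite [y j 0 * _]mulrC -scalerDr gen_anticomm eq_sym (negPf ji) oppr0
  mul0rn scaler0.
Qed.

End CliffordAlgebra.
Arguments gen {R A m} i.
Arguments vec {R A m} x.
Arguments omega {R A m}.

(* Notions attached to a Clifford multiplication cl : R^n -> End S on a real
   module S. Elements of (S (x) S)^* = S^* (x) S^* are bilinear forms. *)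
Section SpinorForms.
Variables (R : rcfType) (n : nat) (S : lmodType R).
Variable cl : 'cV[R]_n -> S -> S.
Implicit Types (b h : S -> S -> R) (phi : 'cV[R]_n -> S -> S -> R).

Definition form_bilinear b : Prop :=
  (forall t, scalar (b^~ t)) /\ (forall s, scalar (b s)).

Definition form_symmetric b : Prop := forall s t, b s t = b t s.
Definition form_skew b : Prop := forall s t, b s t = - b t s.

(* The spinor representation of so(n) = {X | X^T = - X}: X acts as the element
   a = - 1/4 \sum_(i, j) X i j e_i e_j of the Clifford algebra, which is the
   one in the span of the e_i e_j (i < j) such that [a, v] = X v for all v, cf.
   [spin_action_commutator] below. *)
Definition spin_action (X : 'M[R]_n) (s : S) : S :=
  - (4^-1 *: \sum_i \sum_j
      X i j *: cl (delta_mx i 0) (cl (delta_mx j 0) s)).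

Definition so_equivariant phi : Prop :=
  forall X : 'M[R]_n, X^T = - X -> forall v s t,
    phi (X *m v) s t = - phi v (spin_action X s) t - phi v s (spin_action X t).

Definition so_embedding phi : Prop :=
  [/\ forall v, form_bilinear (phi v),
      forall s t, scalar (fun v => phi v s t),
      so_equivariant phi
    & forall v w, phi v =2 phi w -> v = w].

Definition scalar_product h : Prop :=
  [/\ form_bilinear h, form_symmetric h & forall s, s != 0 -> 0 < h s s].

Definition clifford_invariant h : Prop :=
  forall v : 'cV[R]_n, \sum_i v i 0 ^+ 2 = 1 -> forall s t, h (cl v s) (cl v t) = h s t.

Definition jrho b : 'cV[R]_n -> S -> S -> R := fun v s t => b (cl v s) t.

Lemma spin_action_commutator :
  (forall s, linear (cl^~ s)) -> (forall v, linear (cl v)) ->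
  (forall (v w : 'cV[R]_n) s,
     cl v (cl w s) + cl w (cl v s) = - ((2 * \sum_i v i 0 * w i 0) *: s)) ->
  forall X : 'M[R]_n, X^T = - X -> forall (v : 'cV[R]_n) s,
    cl (X *m v) s = spin_action X (cl v s) - cl v (spin_action X s).
Proof.
move=> lin_l lin_r rel X asymX v s.
pose e i : 'cV[R]_n := delta_mx i 0.
have clD w x y : cl w (x + y) = cl w x + cl w y.
  by rewrite -[x]scale1r lin_r !scale1r.
have cl0 w : cl w 0 = 0.
  by have /esym/eqP := clD w 0 0; rewrite addr0 -subr_eq0 addrK => /eqP.
have clZ w a x : cl w (a *: x) = a *: cl w x.
  by rewrite -[a *: x]addr0 lin_r cl0 addr0.
have clN w x : cl w (- x) = - cl w x by rewrite -scaleN1r clZ scaleN1r.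
have cl_sum w (F : 'I_n -> S) : cl w (\sum_i F i) = \sum_i cl w (F i).
  by apply: (big_morph (cl w) (clD w) (cl0 w)).
have cl'D x y w : cl (x + y) w = cl x w + cl y w.
  by rewrite -[x]scale1r lin_l !scale1r.
have cl'0 w : cl 0 w = 0.
  by have /esym/eqP := cl'D 0 0 w; rewrite addr0 -subr_eq0 addrK => /eqP.
have cl'Z a x w : cl (a *: x) w = a *: cl x w.
  by rewrite -[a *: x]addr0 lin_l cl'0 addr0.
have coord (x : 'cV[R]_n) w : cl x w = \sum_i x i 0 *: cl (e i) w.
  rewrite {1}[x]matrix_sum_delta.
  rewrite (big_morph (cl^~ w) (fun x y => cl'D x y w) (cl'0 w)).
  by apply: eq_bigr => i _; rewrite big_ord1 cl'Z.
have relE i w : cl (e i) (cl v w) = - cl v (cl (e i) w) - (2 * v i 0) *: w.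
  have /eqP := rel (e i) v w.
  rewrite (bigD1 i) //= big1 => [|j ji]; last first.
    by rewrite mxE (negPf ji) mul0r.
  by rewrite mxE !eqxx mul1r addr0 => /eqP/(canRL (addrK _)) ->; rewrite addrC.
have term i j : cl (e i) (cl (e j) (cl v s)) = cl v (cl (e i) (cl (e j) s)) +
    ((2 * v i 0) *: cl (e j) s - (2 * v j 0) *: cl (e i) s).
  by rewrite relE -scaleNr clD clZ clN relE scaleNr opprD !opprK addrA.
have sum_swap : \sum_i \sum_j X i j *: ((2 * v i 0) *: cl (e j) s) =
    - \sum_i \sum_j X i j *: ((2 * v j 0) *: cl (e i) s).
  rewrite exchange_big -sumrN; apply: eq_bigr => i _; rewrite -sumrN.
  apply: eq_bigr => j _; rewrite -scaleNr; congr (_ *: _).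
  by have /matrixP/(_ i j) := asymX; rewrite !mxE.
set T := \sum_i \sum_j X i j *: ((2 * v j 0) *: cl (e i) s) in sum_swap.
have -> : cl (X *m v) s = 2^-1 *: T.
  rewrite coord /T scaler_sumr; apply: eq_bigr => i _.
  rewrite mxE scaler_suml scaler_sumr; apply: eq_bigr => j _.
  by rewrite !scalerA mulrCA mulKf ?pnatr_eq0.
have -> : spin_action X (cl v s) =
    cl v (spin_action X s) - 4^-1 *: (- T - T).
  rewrite /spin_action clN clZ -opprD -scalerDr; congr (- (_ *: _)).
  rewrite -{1}sum_swap /T cl_sum -sumrB -big_split; apply: eq_bigr => i _ /=.
  rewrite cl_sum -sumrB -big_split; apply: eq_bigr => j _ /=.
  by rewrite term scalerDr clZ -scalerBr.
rewrite addrAC subrr add0r -opprD scalerN opprK -mulr2n -scaler_nat scalerA.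
by congr (_ *: _); rewrite -[4%N]/(2 * 2)%N natrM invfM mulfVK ?pnatr_eq0.
Qed.

End SpinorForms.

HB.instance Definition _ (R : rcfType) :=
  GRing.Lalgebra_isComAlgebra.Build R (Rcomplex R).

Notation Cl R m := (clifford (R := R) R^o m).
Notation CCl R m := (clifford (R := R) (Rcomplex R) m).

Section SpinorModules.
Variables (R : rcfType) (m : nat).

Definition opI (s : CCl R m) : CCl R m :=
  Clifford [ffun B : {set 'I_m} => ('i%C : Rcomplex R) * s B].

Definition opc (s : CCl R m) : CCl R m :=
  Clifford [ffun B : {set 'I_m} => (conjc (s B) : Rcomplex R)].

(* R^(2m) is R^m + R^m, with x ~> x~ the identity from the first to the second
   summand; R^(2m+1) is R e_0 + R^(2m). *)

(* rho on S_(2m,0) = Cl_m, for m = 3 mod 4. *)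
Definition rho_real (x : 'cV[R]_(m + m)) (s : Cl R m) : Cl R m :=
  vec (usubmx x) * s + omega * alpha s * vec (dsubmx x).

(* rho on S_(2m,0) = CCl_m for m = 1, 2 mod 4, and the complex linear extension
   of rho to S_(2m,0) (x) C = CCl_m for m = 0 mod 4. *)
Definition rho_complex (x : 'cV[R]_(m + m)) (s : CCl R m) : CCl R m :=
  vec (usubmx x) * s +
  (if (m %% 4 == 0)%N then omega * s * vec (dsubmx x)
   else opI (alpha s * vec (dsubmx x))).

(* The action e_1 .. e_m e~_1 .. e~_m of the volume element of Cl_(2m). *)
Definition rho_volume (S : Type) (rho : 'cV[R]_(m + m) -> S -> S) : S -> S :=
  \big[(fun f g => f \o g)/id]_(i < m + m) rho (delta_mx i 0).

Definition trho_real (v : 'cV[R]_(1 + (m + m))) (s : Cl R m) : Cl R m :=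
  usubmx v 0 0 *: rho_volume rho_real s + rho_real (dsubmx v) s.

Definition trho_complex (v : 'cV[R]_(1 + (m + m))) (s : CCl R m) : CCl R m :=
  usubmx v 0 0 *: (if odd m then rho_volume rho_complex s
                   else opI (rho_volume rho_complex s))
  + rho_complex (dsubmx v) s.

Definition opJ (s : CCl R m) : CCl R m :=
  if (m %% 4 == 0)%N then alpha (opc s) else omega * opc s.

Definition opK (s : CCl R m) : CCl R m := opI (opJ s).

Definition Splus (s : CCl R m) : Prop :=
  forall B : {set 'I_m},
    if odd #|B| then complex.Re (s B) = 0 else complex.Im (s B) = 0.

Definition Sminus (s : CCl R m) : Prop := exists2 t, Splus t & s = opI t.

Definition orthogonal_halves (b : CCl R m -> CCl R m -> R) : Prop :=
  forall s t, Splus s -> Sminus t -> b s t = 0 /\ b t s = 0.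

Definition isotropic_halves (b : CCl R m -> CCl R m -> R) : Prop :=
  (forall s t, Splus s -> Splus t -> b s t = 0) /\
  (forall s t, Sminus s -> Sminus t -> b s t = 0).

End SpinorModules.

(* Main.v *)
Require Import Defs.
From HB Require Import structures.
From mathcomp Require Import all_boot all_order all_algebra.
From mathcomp Require Import complex reals ring.

Set Implicit Arguments.
Unset Strict Implicit.
Unset Printing Implicit Defensive.

Import Order.TTheory GRing.Theory Num.Theory.
Local Open Scope ring_scope.

(** Write e_i (0 <= i <= 2m) for the images of the orthonormal basis in End S.

    A positive definite form h_0, for which the blades (times 1, and i when S is
    complex) are orthonormal, is preserved by all e_i. Through it, a family of
    bilinear forms phi_v corresponds to a linear map v -> F(v) into End S with
    phi_v(s, t) = h_0(F(v) s, t), and equivariance of phi becomes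
    F(X v) = [X, F(v)]. Applying this to the rotations of the coordinate planes
    shows that F(e_i) anticommutes with e_i e_j, and that F(e_j) = e_i e_j F(e_i),
    for i different from j. Hence A = - F(e_i) e_i does not depend on i, commutes
    with all products e_i e_j, and F(v) = A v ([equivariant_factor]). Conversely each injective A that commutes
    with the even subalgebra gives an embedding ([embedding_of_commutant]). So the
    classification of embeddings is the computation of the commutant of the even
    subalgebra; no decomposition of S (x) S is needed.

    The commutant is found in the model. The even subalgebra contains the volume
    element of Cl_2m, hence also the vectors of R^(2m), up to a factor I when m is
    even ([extension_even_commutant]). An operator that is linear over the
    coefficients and commutes with R^(2m) commutes with left multiplications, so
    it is a right multiplication, by an element that the second summand of R^(2m)
    forces to be central, or central up to alpha; by inspection of the blades it
    is a scalar ([doubled_schur]). For m = 3 mod 4 this is the whole commutant.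
    Otherwise the complex linear part of A is of this kind, and so is J composed
    with its antilinear part, whence A is in the span of Id, I, J, K
    ([even_commutant_span]).

    The same computation shows that the given form h is a multiple of h_0
    ([invariant_form_unique]), so that I and J are isometries of h. The symmetry
    of h(A v s, t) then depends only on the signs A^2 = +-1 and A v = +- v A
    ([jrho_symmetry]). For m = 0 mod 4, S^+ and S^- lie in the eigenspaces of J to
    the eigenvalues 1 and -1, and J anticommutes with vectors, which gives the
    isotropy and orthogonality statements ([jrho_vanish]). *)

(** * Linear maps and bilinear forms given by their laws *)

Section LinearMaps.
Variables (R : nzRingType) (U V : lmodType R) (f : U -> V).
Hypothesis lin_f : linear f.

Let F : {linear U -> V} := HB.pack f (GRing.isLinear.Build R U V *:%R f lin_f).

Lemma lin0 : f 0 = 0. Proof. exact: (linear0 F). Qed.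
Lemma linD s t : f (s + t) = f s + f t. Proof. exact: (linearD F). Qed.
Lemma linN s : f (- s) = - f s. Proof. exact: (linearN F). Qed.
Lemma linB s t : f (s - t) = f s - f t. Proof. exact: (linearB F). Qed.
Lemma linZ a s : f (a *: s) = a *: f s. Proof. exact: (linearZZ F). Qed.
Lemma lin_sum I (r : seq I) (P : pred I) (g : I -> U) :
  f (\sum_(i <- r | P i) g i) = \sum_(i <- r | P i) f (g i).
Proof. exact: (linear_sum F). Qed.

End LinearMaps.

Lemma half_double (R : rcfType) (S : lmodType R) (s : S) : 2^-1 *: (s + s) = s.
Proof. by rewrite -mulr2n -scaler_nat scalerA mulVf ?scale1r ?pnatr_eq0. Qed.

Lemma lmod_eqN0 (R : rcfType) (S : lmodType R) (s : S) : s = - s -> s = 0.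
Proof. by move=> ss; rewrite -[s]half_double {2}ss subrr scaler0. Qed.

Section BilinearForms.
Variables (R : rcfType) (S : lmodType R) (b : S -> S -> R).
Hypothesis bb : form_bilinear b.

Let linl t : linear (b^~ t : S -> R^o). Proof. exact: (proj1 bb). Qed.
Let linr s : linear (b s : S -> R^o). Proof. exact: (proj2 bb). Qed.

Lemma formDl s t u : b (s + t) u = b s u + b t u. Proof. exact: (linD (linl u)). Qed.
Lemma formNl s u : b (- s) u = - b s u. Proof. exact: (linN (linl u)). Qed.
Lemma formZl a s u : b (a *: s) u = a * b s u. Proof. exact: (linZ (linl u)). Qed.
Lemma form0l u : b 0 u = 0. Proof. exact: (lin0 (linl u)). Qed.
Lemma formDr u s t : b u (s + t) = b u s + b u t. Proof. exact: (linD (linr u)). Qed.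
Lemma formNr u s : b u (- s) = - b u s. Proof. exact: (linN (linr u)). Qed.
Lemma formZr a u s : b u (a *: s) = a * b u s. Proof. exact: (linZ (linr u)). Qed.
Lemma form_suml I (r : seq I) (P : pred I) (g : I -> S) u :
  b (\sum_(i <- r | P i) g i) u = \sum_(i <- r | P i) b (g i) u.
Proof. exact: (lin_sum (linl u)). Qed.
Lemma form_sumr I (r : seq I) (P : pred I) (g : I -> S) u :
  b u (\sum_(i <- r | P i) g i) = \sum_(i <- r | P i) b u (g i).
Proof. exact: (lin_sum (linr u)). Qed.

End BilinearForms.

Lemma scalar_product_inj (R : rcfType) (S : lmodType R) (h : S -> S -> R) :
  scalar_product h -> forall s t, h s =1 h t -> s = t.
Proof.
case=> bil _ pos s t st; apply/eqP; rewrite -subr_eq0; apply: contraT => /pos.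
by rewrite (formDl bil) (formNl bil) st subrr ltxx.
Qed.

(** * Products of anticommuting operators *)

Section AnticommutingProducts.
Variables (R : rcfType) (S : lmodType R) (I : eqType) (G : I -> S -> S).
Implicit Types (r : seq I) (s : S).

(** The composite of the operators [G i], for [i] in [r], the first one
    outermost. When [r] enumerates the index type this is, by conversion, the
    product in [rho_volume]. *)
Definition opprod r : S -> S := \big[(fun f g => f \o g)/id]_(i <- r) G i.

Lemma opprod_nil s : opprod [::] s = s.
Proof. by rewrite /opprod big_nil. Qed.

Lemma opprod_cons i r s : opprod (i :: r) s = G i (opprod r s).
Proof. by rewrite /opprod big_cons. Qed.

Lemma opprod_comm (A : S -> S) r : (forall i s, A (G i s) = G i (A s)) ->
  forall s, A (opprod r s) = opprod r (A s).
Proof.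
move=> AG; elim: r => [|i r IHr] s; first by rewrite !opprod_nil.
by rewrite !opprod_cons AG IHr.
Qed.

Lemma opprod_isometry (h : S -> S -> R) r :
  (forall i s t, h (G i s) (G i t) = h s t) ->
  forall s t, h (opprod r s) (opprod r t) = h s t.
Proof.
move=> hG s t; elim: r => [|i r IHr]; first by rewrite !opprod_nil.
by rewrite !opprod_cons hG IHr.
Qed.

(** An operator that commutes with all products of two of the [G i] commutes
    with all their products of even length. *)
Lemma opprod_comm_even (A : S -> S) r :
  (forall i j s, A (G i (G j s)) = G i (G j (A s))) -> ~~ odd (size r) ->
  forall s, A (opprod r s) = opprod r (A s).
Proof.
move=> AGG; suff [//] : (~~ odd (size r) ->
    forall s, A (opprod r s) = opprod r (A s)) /\
  (odd (size r) ->
    forall j s, A (G j (opprod r s)) = G j (opprod r (A s))).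
elim: r => [|i r [IHe IHo]]; first by split=> // _ s; rewrite !opprod_nil.
split=> /= [/negPn r_odd s|r_even j s]; rewrite !opprod_cons; first exact: IHo.
by rewrite AGG IHe.
Qed.

Hypothesis G_lin : forall i, linear (G i).

Lemma opprod_linear r : linear (opprod r).
Proof.
move=> a s t; elim: r => [|i r IHr]; first by rewrite !opprod_nil.
by rewrite !opprod_cons IHr G_lin.
Qed.

(** Each factor contributes a sign: an operator that commutes with all [G i] up
    to the sign (-1) ^+ [e] commutes with the product up to the power of it. *)
Lemma opprod_scomm (A : S -> S) (e : nat) r : linear A ->
  (forall i s, A (G i s) = (-1) ^+ e *: G i (A s)) ->
  forall s, A (opprod r s) = (-1) ^+ (e * size r) *: opprod r (A s).
Proof.
move=> A_lin AG; elim: r => [|i r IHr] s.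
  by rewrite !opprod_nil muln0 scale1r.
by rewrite !opprod_cons AG IHr (linZ (G_lin i)) scalerA -exprD mulnS.
Qed.

Hypothesis G_sq : forall i s, G i (G i s) = - s.
Hypothesis G_anti : forall i j s, i != j -> G i (G j s) = - G j (G i s).

(** [G k] passes each factor with a sign -1, except itself. *)
Lemma opprod_swap r k s : uniq r ->
  G k (opprod r s) = (-1) ^+ (size r + (k \in r)) *: opprod r (G k s).
Proof.
elim: r => [_|i r IHr]; first by rewrite !opprod_nil scale1r.
move=> /= /andP[ir ur]; rewrite !opprod_cons inE.
case: (eqVneq k i) IHr => [->|ki] IHr.
  move: (IHr ur); rewrite (negPf ir) /= addn0 => {}IHr.
  by rewrite addn1 !exprS !mulN1r opprK -(linZ (G_lin i)) -IHr.
rewrite G_anti // IHr // (linZ (G_lin i)) -scaleNr.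
by rewrite addSn exprS mulN1r.
Qed.

Lemma opprod_sqr r s : uniq r ->
  opprod r (opprod r s) = (-1) ^+ 'C((size r).+1, 2) *: s.
Proof.
elim: r s => [|i r IHr] s; first by rewrite !opprod_nil scale1r.
move=> /= /andP[ir ur]; rewrite !opprod_cons.
have := opprod_swap i (opprod r s) ur; rewrite (negPf ir) /= addn0 => swap.
have -> : opprod r (G i (opprod r s)) = (-1) ^+ size r *: G i (opprod r (opprod r s)).
  by rewrite swap scalerA -exprD addnn -signr_odd odd_double scale1r.
rewrite IHr // !(linZ (G_lin i)) G_sq !scalerN scalerA -exprD.
by rewrite -scaleNr -mulN1r -exprS [in RHS]binS bin1 addnS addnC.
Qed.

End AnticommutingProducts.

(** * Equivariant families of forms and the commutant of the even subalgebra *)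

(** A Clifford multiplication: [cl] is bilinear and the images of the
    orthonormal basis of R^n satisfy the relations of Cl_n. *)
Definition clifford_action (R : rcfType) (n : nat) (S : lmodType R)
    (cl : 'cV[R]_n -> S -> S) : Prop :=
  [/\ forall s, linear (cl^~ s), forall v, linear (cl v),
      forall i s, cl (delta_mx i 0) (cl (delta_mx i 0) s) = - s
    & forall i j s, i != j -> cl (delta_mx i 0) (cl (delta_mx j 0) s) =
                              - cl (delta_mx j 0) (cl (delta_mx i 0) s)].

(** [A] is linear and commutes with the products of two basis vectors, hence
    with the image of the even subalgebra of Cl_n. *)
Definition even_commutant (R : rcfType) (n : nat) (S : lmodType R)
    (cl : 'cV[R]_n -> S -> S) (A : S -> S) : Prop :=
  linear A /\ forall i j s,
    A (cl (delta_mx i 0) (cl (delta_mx j 0) s)) =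
    cl (delta_mx i 0) (cl (delta_mx j 0) (A s)).

Section EquivariantForms.
Variables (R : rcfType) (n : nat) (S : lmodType R) (cl : 'cV[R]_n -> S -> S).
Hypothesis cl_action : clifford_action cl.

Let lin_l s : linear (cl^~ s). Proof. by case: cl_action. Qed.
Let lin_r v : linear (cl v). Proof. by case: cl_action. Qed.

Let e (i : 'I_n) : 'cV[R]_n := delta_mx i 0.
Let E i : S -> S := cl (e i).

Let E_sq i s : E i (E i s) = - s.
Proof. by case: cl_action => _ _ sq _; apply: sq. Qed.
Let E_anti i j s : i != j -> E i (E j s) = - E j (E i s).
Proof. by case: cl_action => _ _ _ anti; apply: anti. Qed.
Let EN i s : E i (- s) = - E i s. Proof. exact: (linN (lin_r _)). Qed.
Let E_sum i (F : 'I_n -> S) : E i (\sum_j F j) = \sum_j E i (F j).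
Proof. exact: (lin_sum (lin_r _)). Qed.
Let EZ i a s : E i (a *: s) = a *: E i s. Proof. exact: (linZ (lin_r _)). Qed.

Lemma cl_coord (V : lmodType R) (f : 'cV[R]_n -> V) v : linear f ->
  f v = \sum_i v i 0 *: f (delta_mx i 0).
Proof.
move=> lin_f; rewrite {1}[v]matrix_sum_delta (lin_sum lin_f).
by apply: eq_bigr => i _; rewrite big_ord1 (linZ lin_f).
Qed.

Let cl_coordE v s : cl v s = \sum_i v i 0 *: E i s.
Proof. exact: (cl_coord v (lin_l s)). Qed.

Lemma cl_anticomm (v w : 'cV[R]_n) s :
  cl v (cl w s) + cl w (cl v s) = - ((2 * \sum_i v i 0 * w i 0) *: s).
Proof.
have EE x y : cl x (cl y s) = \sum_i \sum_j (x i 0 * y j 0) *: E i (E j s).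
  rewrite cl_coordE; apply: eq_bigr => i _.
  rewrite [cl y s]cl_coordE E_sum scaler_sumr.
  by apply: eq_bigr => j _; rewrite EZ scalerA.
rewrite !EE [X in _ + X]exchange_big -big_split mulr_sumr scaler_suml -sumrN.
apply: eq_bigr => i _; rewrite -big_split (bigD1 i) //= big1 => [|j ji].
  by rewrite addr0 E_sq [w i 0 * _]mulrC -scalerDr -mulr2n
    -scaler_nat scalerA scalerN [_ * 2]mulrC.
by rewrite [w j 0 * _]mulrC -scalerDr E_anti 1?eq_sym // addNr scaler0.
Qed.

Lemma cl_faithful v s : s != 0 -> cl v s = 0 -> v = 0.
Proof.
move=> s0 vs; have := cl_anticomm v v s; rewrite vs (lin0 (lin_r v)) addr0.
move=> /esym/eqP; rewrite oppr_eq0 scaler_eq0 (negPf s0) orbF mulf_eq0.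
rewrite pnatr_eq0 /= psumr_eq0 => [/allP v0|i _]; last first.
  by rewrite -expr2 sqr_ge0.
apply/colP => i; rewrite mxE; apply/eqP.
by have := v0 i (mem_index_enum _); rewrite mulf_eq0 orbb.
Qed.

Let spinE X s :
  spin_action cl X s = - (4^-1 *: \sum_i \sum_j X i j *: E i (E j s)).
Proof. by []. Qed.

(** The spin action is skew for every form for which vectors are skew. *)
Lemma spin_action_skew (h : S -> S -> R) (X : 'M[R]_n) : form_bilinear h ->
  (forall v s t, h (cl v s) t = - h s (cl v t)) -> X^T = - X ->
  forall s t, h (spin_action cl X s) t = - h s (spin_action cl X t).
Proof.
move=> bh skew asymX s t; rewrite !spinE !(formNl, formNr) // opprK.
rewrite formZl // formZr // -mulrN; congr (_ * _).
rewrite [in LHS]exchange_big form_suml // form_sumr // -sumrN; apply: eq_bigr => i _.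
rewrite form_suml // form_sumr // -sumrN; apply: eq_bigr => j _.
rewrite formZl // formZr // !skew opprK -mulNr.
by have /matrixP/(_ i j) := asymX; rewrite !mxE => ->; rewrite opprK.
Qed.

Lemma spin_action_comm (A : S -> S) X s : even_commutant cl A ->
  A (spin_action cl X s) = spin_action cl X (A s).
Proof.
case=> A_lin AEE; rewrite !spinE (linN A_lin) (linZ A_lin); congr (- (_ *: _)).
rewrite (lin_sum A_lin); apply: eq_bigr => i _.
rewrite (lin_sum A_lin); apply: eq_bigr => j _.
by rewrite (linZ A_lin) AEE.
Qed.

(** The forms h(A v s, t) are an embedding when [A] is injective and commutes
    with the even subalgebra. *)
Lemma embedding_of_commutant (h : S -> S -> R) (A : S -> S) :
  scalar_product h -> (forall v s t, h (cl v s) t = - h s (cl v t)) ->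
  even_commutant cl A -> (forall s, A s = 0 -> s = 0) -> (exists s : S, s != 0) ->
  so_embedding cl (jrho cl (fun s t => h (A s) t)).
Proof.
move=> hP skew Acomm A_inj [s0 s0_neq0].
have [bh _ _] := hP; have [A_lin _] := Acomm; split.
- move=> v; split=> [t a s u|s a t u]; rewrite /jrho.
    by rewrite lin_r A_lin formDl // formZl.
  by rewrite formDr // formZr.
- by move=> s t a v w; rewrite /jrho lin_l A_lin formDl // formZl.
- move=> X asymX v s t.
  rewrite /jrho (spin_action_commutator lin_l lin_r cl_anticomm asymX).
  rewrite (linB A_lin) formDl // formNl // (spin_action_comm _ _ Acomm).
  by rewrite (spin_action_skew bh skew asymX) addrC.
- move=> v w vw; apply/eqP; rewrite -subr_eq0; apply/eqP.
  apply: (cl_faithful s0_neq0); apply: A_inj.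
  rewrite (linB (lin_l s0)) (linB A_lin); apply/eqP; rewrite subr_eq0; apply/eqP.
  by apply: (scalar_product_inj hP) => t; apply: vw.
Qed.

(* The rotation of the plane (e_i, e_j) acts as -1/2 e_i e_j. *)
Let spin_elem i j s : i != j ->
  spin_action cl (delta_mx i j - delta_mx j i) s = - (2^-1 *: E i (E j s)).
Proof.
have sum_delta k l :
    \sum_i \sum_j (delta_mx k l : 'M[R]_n) i j *: E i (E j s) = E k (E l s).
  rewrite (bigD1 k) //= (bigD1 l) //= mxE !eqxx scale1r.
  rewrite !big1 ?addr0 // => [i' /negPf ik|j' /negPf jl].
    by rewrite big1 // => j' _; rewrite mxE ik scale0r.
  by rewrite mxE jl andbF scale0r.
move=> ij; rewrite spinE.
under eq_bigr => k _ do
  (under eq_bigr => l _ do rewrite !mxE scalerBl; rewrite sumrB).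
rewrite sumrB.
have := sum_delta i j; under eq_bigr => k _ do under eq_bigr => l _ do rewrite mxE.
move=> ->.
have := sum_delta j i; under eq_bigr => k _ do under eq_bigr => l _ do rewrite mxE.
move=> ->.
rewrite [E j (E i s)]E_anti 1?eq_sym // opprK -mulr2n -scaler_nat scalerA.
by rewrite -[4%N]/(2 * 2)%N natrM invfM mulfVK ?pnatr_eq0.
Qed.

(** An isometry of square -1 is skew; this extends from the basis vectors to all
    vectors by linearity. *)
Lemma isometry_skew (h : S -> S -> R) : form_bilinear h ->
  (forall i s t, h (cl (delta_mx i 0) s) (cl (delta_mx i 0) t) = h s t) ->
  forall v s t, h (cl v s) t = - h s (cl v t).
Proof.
move=> bh iso v s t; rewrite !cl_coordE form_suml // form_sumr // -sumrN.
apply: eq_bigr => i _; rewrite formZl // formZr // -mulrN; congr (_ * _).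
by rewrite -(iso i s) [cl _ (E i t)]E_sq formNr // opprK.
Qed.

(** [rep] represents the linear forms on [S] by vectors, through [h]. *)
Section Factorization.
Variables (h : S -> S -> R) (rep : (S -> R) -> S) (i0 : 'I_n).
Hypothesis hP : scalar_product h.
Hypothesis h_iso : forall i s t,
  h (cl (delta_mx i 0) s) (cl (delta_mx i 0) t) = h s t.
Hypothesis repP : forall f : S -> R, scalar f -> forall t, f t = h (rep f) t.

Let bh : form_bilinear h. Proof. by case: hP. Qed.

(** Every bilinear form is h(F s, t) for a linear [F]. *)
Lemma form_operator b : form_bilinear b ->
  exists2 F : S -> S, linear F & forall s t, b s t = h (F s) t.
Proof.
case=> b_l b_r; exists (fun s => rep (b s)) => [a s s'|s t]; last exact: repP.
apply: (scalar_product_inj hP) => t.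
by rewrite formDl // formZl // -!repP // b_l.
Qed.

(** The operator of an invariant form commutes with the unit vectors [e i]. *)
Lemma invariant_form_operator b : form_bilinear b -> clifford_invariant cl b ->
  exists B : S -> S, [/\ linear B, forall s t, b s t = h (B s) t
    & forall i s, B (cl (delta_mx i 0) s) = cl (delta_mx i 0) (B s)].
Proof.
move=> bb b_inv; have [B B_lin bB] := form_operator bb; exists B; split=> // i s.
have unit_e : \sum_j (delta_mx i 0 : 'cV[R]_n) j 0 ^+ 2 = 1.
  rewrite (bigD1 i) //= big1 => [|j /negPf ji]; rewrite mxE ?eqxx ?ji.
    by rewrite expr1n addr0.
  by rewrite expr0n.
apply: (scalar_product_inj hP) => t.
have -> : t = cl (delta_mx i 0) (- cl (delta_mx i 0) t).
  by rewrite (linN (lin_r _)) [cl _ (cl _ t)]E_sq opprK.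
by rewrite -bB b_inv // h_iso bB.
Qed.

Section OneForm.
Variables (phi : 'cV[R]_n -> S -> S -> R) (F : 'cV[R]_n -> S -> S).
Hypothesis phi_equi : so_equivariant cl phi.
Hypothesis F_lin : forall v, linear (F v).
Hypothesis phiE : forall v s t, phi v s t = h (F v s) t.

(* The components f i = F(e_i) are related by the rotations of the coordinate
   planes. *)
Let f i := F (e i).

Let F_equi i j v s : i != j ->
  F ((delta_mx i j - delta_mx j i) *m v) s =
  2^-1 *: (F v (E i (E j s)) - E i (E j (F v s))).
Proof.
move=> ij; apply: (scalar_product_inj hP) => t; rewrite -phiE phi_equi; last first.
  by rewrite linearB /= !trmx_delta opprB.
have skew := isometry_skew bh h_iso.
rewrite !spin_elem // !phiE (linN (F_lin v)) (linZ (F_lin v)).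
rewrite formNl // formNr // !opprK !formZl // formZr // -mulrDr formDl // formNl //.
congr (_ * (_ + _)); rewrite -[LHS]opprK -[h _ _]opprK -skew -skew E_anti //.
by rewrite formNl // opprK.
Qed.

Let fN i s : f i (- s) = - f i s. Proof. exact: (linN (F_lin _)). Qed.

Let X_e i j k :
  (delta_mx i j - delta_mx j i) *m e k = e i *+ (j == k) - e j *+ (i == k).
Proof. by rewrite mulmxBl !mul_delta_mx_cond. Qed.

Hypothesis F_lin_l : forall s, linear (F^~ s).

Let f_half i j s : i != j -> f i s = 2^-1 *: (f j (E i (E j s)) - E i (E j (f j s))).
Proof.
move=> ij; have := F_equi (e j) s ij.
by rewrite X_e eqxx (negPf ij) mulr1n subr0.
Qed.

(* Put P = E i o E j, so that P P = -1. By [f_half], f i is half the commutator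
   of f j with P, hence anticommutes with P. *)
Let f_acomm i j s : i != j -> E i (E j (f i s)) = - f i (E i (E j s)).
Proof.
move=> ij; have PP t : E i (E j (E i (E j t))) = - t.
  by rewrite [E j (E i _)]E_anti 1?eq_sym // EN !E_sq opprK.
rewrite !(f_half _ ij) !EZ -scalerN; congr (_ *: _).
have ED k u w : E k (u + w) = E k u + E k w by exact: (linD (lin_r _)).
by rewrite !(ED, EN) !PP fN opprB !opprK.
Qed.

Let f_rot i j s : i != j -> f j s = E i (E j (f i s)).
Proof.
move=> ij; rewrite (@f_half j i) 1?eq_sym //.
rewrite -[RHS]half_double; congr (_ *: _).
rewrite [E j (E i s)]E_anti 1?eq_sym // fN -f_acomm //; congr (_ + _).
by rewrite [E j (E i _)]E_anti 1?eq_sym // opprK.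
Qed.

(* A = - f i E i = f i (E i)^-1, for any choice of the index i. *)
Let A s := - f i0 (E i0 s).

Let fA i s : A (E i s) = f i s.
Proof.
rewrite /A; have [->|ij] := eqVneq i i0; first by rewrite E_sq fN opprK.
by rewrite [RHS](@f_rot i0) 1?eq_sym // f_acomm // eq_sym.
Qed.

Let A_comm i j s : A (E i (E j s)) = E i (E j (A s)).
Proof.
have AN t : A (- t) = - A t by rewrite /A EN fN.
have [<-|ij] := eqVneq i j; first by rewrite !E_sq AN.
have AE k t : A t = - f k (E k t) by rewrite -fA E_sq AN opprK.
rewrite [LHS](AE i) E_sq fN opprK (AE i s) !EN.
rewrite f_acomm // opprK [E j (E i s)]E_anti 1?eq_sym //.
by rewrite EN E_sq opprK.
Qed.

(** The operator A = - F(e_i) e_i does not depend on i, and F(v) = A v. *)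
Lemma equivariant_operator : exists2 B : S -> S, even_commutant cl B &
  forall v s, F v s = B (cl v s).
Proof.
have A_lin : linear A.
  by move=> a s t; rewrite /A /f /E lin_r F_lin opprD scalerN.
exists A; first by split=> // i j s; apply: A_comm.
move=> v s; rewrite cl_coordE (cl_coord v (F_lin_l s)) (lin_sum A_lin).
by apply: eq_bigr => i _; rewrite (linZ A_lin) fA.
Qed.

End OneForm.

(** An equivariant family of forms is v, s, t -> h(A v s, t) for some [A] that
    commutes with the even subalgebra. *)
Lemma equivariant_factor phi : so_embedding cl phi ->
  exists2 A : S -> S, even_commutant cl A &
    forall v s t, phi v s t = h (A (cl v s)) t.
Proof.
case=> phi_bil phi_lin phi_equi _.
pose F v s := rep (phi v s).
have phiE v s t : phi v s t = h (F v s) t.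
  by rewrite /F -repP //; case: (phi_bil v).
have F_lin v : linear (F v).
  move=> a s t; apply: (scalar_product_inj hP) => u.
  by rewrite formDl // formZl // -!phiE; case: (phi_bil v) => + _; apply.
have F_lin_l s : linear (F^~ s).
  move=> a v w; apply: (scalar_product_inj hP) => u.
  by rewrite formDl // formZl // -!phiE phi_lin.
have [A A_comm FA] := equivariant_operator phi_equi F_lin phiE F_lin_l.
by exists A => // v s t; rewrite phiE FA.
Qed.

End Factorization.
End EquivariantForms.

Section EvenCommutant.
Variables (R : rcfType) (n : nat) (S : lmodType R) (cl : 'cV[R]_n -> S -> S).
Hypothesis cl_action : clifford_action cl.

(** It suffices that [A] commutes with the basis vectors up to a common sign. *)
Lemma even_commutant_scomm (A : S -> S) (d : nat) : linear A ->
  (forall i s, A (cl (delta_mx i 0) s) = (-1) ^+ d *: cl (delta_mx i 0) (A s)) ->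
  even_commutant cl A.
Proof.
have [_ lin_r _ _] := cl_action => A_lin Acl; split=> // i j s.
rewrite Acl Acl (linZ (lin_r _)) scalerA -exprD addnn.
by rewrite -signr_odd odd_double scale1r.
Qed.

End EvenCommutant.

(** * Clifford multiplication by one more vector *)

Section OddExtension.
Variables (R : rcfType) (N : nat) (S : lmodType R) (rho : 'cV[R]_N -> S -> S).
Variable P : S -> S.
Hypothesis N_even : ~~ odd N.
Hypothesis rho_action : clifford_action rho.

Let G i : S -> S := rho (delta_mx i 0).
Let Omega : S -> S := opprod G (index_enum 'I_N).

(** The extension of [rho] to R^(1 + N), where the additional unit vector acts
    as [P] composed with the action of the volume element of Cl_N. *)
Definition extension (v : 'cV[R]_(1 + N)) (s : S) : S :=
  usubmx v 0 0 *: P (opprod (fun i => rho (delta_mx i 0)) (index_enum 'I_N) s)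
  + rho (dsubmx v) s.

Let rho_lin_l s : linear (rho^~ s). Proof. by case: rho_action. Qed.
Let rho_lin_r v : linear (rho v). Proof. by case: rho_action. Qed.
Let G_lin i : linear (G i). Proof. exact: rho_lin_r. Qed.
Let G_sq i s : G i (G i s) = - s.
Proof. by case: rho_action => _ _ sq _; apply: sq. Qed.
Let G_anti i j s : i != j -> G i (G j s) = - G j (G i s).
Proof. by case: rho_action => _ _ _ anti; apply: anti. Qed.

Let OmegaE : Omega = opprod G (index_enum 'I_N). Proof. by []. Qed.
Let size_ord : size (index_enum 'I_N) = N.
Proof. by rewrite [index_enum _]unlock -enumT size_enum_ord. Qed.

Let Omega_lin : linear Omega. Proof. by rewrite OmegaE; apply: opprod_linear. Qed.

Let G_Omega i s : G i (Omega s) = - Omega (G i s).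
Proof.
rewrite OmegaE (opprod_swap G_lin G_anti) ?index_enum_uniq // mem_index_enum size_ord.
by rewrite -signr_odd oddD (negPf N_even) scaleN1r.
Qed.

Let Omega_sq s : Omega (Omega s) = (-1) ^+ 'C(N.+1, 2) *: s.
Proof.
by rewrite OmegaE (opprod_sqr G_lin G_sq G_anti) ?index_enum_uniq // size_ord.
Qed.

Let usub_l (j : 'I_1) : usubmx (delta_mx (lshift N j) 0 : 'cV[R]_(1 + N)) 0 0 = 1.
Proof. by rewrite !mxE ord1 eqxx. Qed.
Let usub_r (j : 'I_N) : usubmx (delta_mx (rshift 1 j) 0 : 'cV[R]_(1 + N)) 0 0 = 0.
Proof. by rewrite !mxE. Qed.
Let dsub_l (j : 'I_1) : dsubmx (delta_mx (lshift N j) 0 : 'cV[R]_(1 + N)) = 0.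
Proof. by apply/colP => i; rewrite !mxE eq_rlshift. Qed.
Let dsub_r (j : 'I_N) :
  dsubmx (delta_mx (rshift 1 j) 0 : 'cV[R]_(1 + N)) = delta_mx j 0.
Proof. by apply/colP => i; rewrite !mxE eq_rshift. Qed.

Let extension_lshift (j : 'I_1) s : extension (delta_mx (lshift N j) 0) s = P (Omega s).
Proof. by rewrite /extension usub_l dsub_l (lin0 (rho_lin_l s)) addr0 scale1r. Qed.

Let extension_rshift j s : extension (delta_mx (rshift 1 j) 0) s = G j s.
Proof. by rewrite /extension usub_r dsub_r scale0r add0r. Qed.

Hypothesis P_lin : linear P.
Hypothesis P_comm : forall i s, P (rho (delta_mx i 0) s) = rho (delta_mx i 0) (P s).

Let P_G i s : P (G i s) = G i (P s). Proof. exact: P_comm. Qed.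

Let P_Omega s : P (Omega s) = Omega (P s).
Proof. by rewrite OmegaE (opprod_comm _ P_comm). Qed.

(** The hypothesis on the square of [P] compensates the square of the volume
    element, so that the additional vector squares to -1. *)
Lemma extension_action :
  (forall s, P (P s) = (-1) ^+ 'C(N.+1, 2).+1 *: s) -> clifford_action extension.
Proof.
move=> P_sq; split.
- move=> s a v w; rewrite /extension /= !linearP /= rho_lin_l !mxE.
  by rewrite scalerDl !scalerA [a * _]mulrC addrACA.
- move=> v a s t; rewrite /extension [opprod _ _ _]Omega_lin P_lin rho_lin_r.
  by rewrite !scalerDr !scalerA [a * _]mulrC -!scalerA addrACA.
- move=> i s; case: (split_ordP i) => j ->; last by rewrite !extension_rshift G_sq.
  rewrite !extension_lshift -P_Omega Omega_sq !(linZ P_lin) P_sq scalerA -exprD.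
  by rewrite addnS -signr_odd /= oddD addbb scaleN1r.
- move=> i j s; case: (split_ordP i) => i' ->; case: (split_ordP j) => j' -> ij;
    rewrite !(extension_lshift, extension_rshift).
  + by rewrite !ord1 eqxx in ij.
  + by rewrite -P_G G_Omega (linN P_lin) opprK.
  + by rewrite -P_G G_Omega (linN P_lin).
  + by rewrite G_anti // -(inj_eq (@rshift_inj 1 N)).
Qed.

Lemma extension_isometry (h : S -> S -> R) :
  (forall i s t, h (rho (delta_mx i 0) s) (rho (delta_mx i 0) t) = h s t) ->
  (forall s t, h (P s) (P t) = h s t) ->
  forall i s t, h (extension (delta_mx i 0) s) (extension (delta_mx i 0) t) = h s t.
Proof.
move=> hG hP i s t; case: (split_ordP i) => j ->.
  by rewrite !extension_lshift hP OmegaE (opprod_isometry _ hG).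
by rewrite !extension_rshift hG.
Qed.

(** As [N] is even, the volume element does not contribute to the sign. *)
Lemma extension_scomm (A : S -> S) (d : nat) : linear A ->
  (forall i s, A (rho (delta_mx i 0) s) = (-1) ^+ d *: rho (delta_mx i 0) (A s)) ->
  (forall s, A (P s) = (-1) ^+ d *: P (A s)) ->
  forall i s, A (extension (delta_mx i 0) s) =
              (-1) ^+ d *: extension (delta_mx i 0) (A s).
Proof.
move=> A_lin AG AP i s; case: (split_ordP i) => j ->; last first.
  by rewrite !extension_rshift; apply: AG.
rewrite !extension_lshift AP OmegaE (opprod_scomm G_lin _ A_lin AG) size_ord.
by rewrite -[(-1) ^+ (d * N)]signr_odd oddM (negPf N_even) andbF scale1r.
Qed.

(** The volume element is a product of an even number of vectors, so that the
    even subalgebra of Cl_(1 + N) contains the elements P e_i. *)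
Lemma extension_even_commutant A : even_commutant extension A ->
  forall i s, A (P (rho (delta_mx i 0) s)) = P (rho (delta_mx i 0) (A s)).
Proof.
case=> A_lin AEE i s; rewrite -/(G i s) -/(G i (A s)).
have A_Omega t : A (Omega t) = Omega (A t).
  rewrite OmegaE opprod_comm_even ?size_ord // => j k u.
  by have := AEE (rshift 1 j) (rshift 1 k) u; rewrite !extension_rshift.
have APOG t : A (P (Omega (G i t))) = P (Omega (G i (A t))).
  have := AEE (lshift N 0) (rshift 1 i) t.
  by rewrite !(extension_lshift, extension_rshift).
(* Omega is invertible, so that s may be replaced by some Omega t; now Omega
   can be moved next to e_i *)
have -> : s = Omega ((-1) ^+ 'C(N.+1, 2) *: Omega s).
  rewrite (linZ Omega_lin) Omega_sq scalerA -exprD addnn.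
  by rewrite -signr_odd odd_double scale1r.
by rewrite G_Omega (linN P_lin) (linN A_lin) APOG -(linN P_lin) -G_Omega A_Omega.
Qed.

End OddExtension.

(** * The Clifford algebra in the basis of blades *)

Section Clifford.
Variables (R : rcfType) (A : comAlgType R) (m : nat).
Local Notation cliff := (clifford (R := R) A m).
Implicit Types (s t u : cliff) (B C D : {set 'I_m}).

Lemma clifford_ext s t : s =1 t -> s = t.
Proof. by move=> st; apply/val_inj/ffunP. Qed.

Lemma coefDE s t B : (s + t) B = s B + t B. Proof. exact: ffunE. Qed.
Lemma coefZE a s B : (a *: s) B = a *: s B. Proof. exact: ffunE. Qed.

Lemma coefN s B : (- s) B = - s B.
Proof. exact: ffunE. Qed.

Lemma coef0 B : (0 : cliff) B = 0.
Proof. exact: ffunE. Qed.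

Lemma coef_sum I (r : seq I) (P : pred I) (F : I -> cliff) B :
  (\sum_(i <- r | P i) F i) B = \sum_(i <- r | P i) F i B.
Proof. by elim/big_rec2: _ => [|i _ y _ <-]; rewrite ?coef0 ?coefDE. Qed.

Lemma symdiffK B : cancel (symdiff B) (symdiff B).
Proof. by move=> C; apply/setP => i; rewrite !inE addbA addbb. Qed.

Lemma symdiffC B C : symdiff B C = symdiff C B.
Proof. by apply/setP => i; rewrite !inE addbC. Qed.

Lemma odd_card_symdiff1 i D : odd #|symdiff [set i] D| = ~~ odd #|D|.
Proof.
have [iD|iD] := boolP (i \in D).
  rewrite (cardsD1 i D) iD /= negbK; congr (odd #|pred_of_set _|).
  by apply/setP => j; rewrite !inE; case: eqP => [->|] //=; rewrite iD.
have -> : symdiff [set i] D = i |: D.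
  by apply/setP => j; rewrite !inE; case: eqP => [->|] //=; rewrite (negPf iD).
by rewrite cardsU1 iD.
Qed.

Lemma blade_mulE B s D :
  (blade A B * s) D = (-1) ^+ inversions B (symdiff B D) * s (symdiff B D).
Proof.
have -> : blade A B * s = clifford_mul (blade A B) s by [].
rewrite ffunE (bigD1 B) //= big1 => [|C /negPf CB].
  by rewrite addr0 ffunE eqxx mul1r.
by rewrite ffunE CB mul0r mulr0.
Qed.

Lemma mul_bladeE B s D :
  (s * blade A B) D = (-1) ^+ inversions (symdiff B D) B * s (symdiff B D).
Proof.
have -> : s * blade A B = clifford_mul s (blade A B) by [].
have symdiffKr C : symdiff (symdiff C D) D = C.
  by rewrite symdiffC [symdiff C D]symdiffC symdiffK.
rewrite ffunE (bigD1 (symdiff B D)) //= big1 => [|C /negPf CB].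
  by rewrite addr0 symdiffKr ffunE eqxx mulr1.
rewrite ffunE; case: eqP => [CDB|_]; last by rewrite !mulr0.
by rewrite -CDB symdiffKr eqxx in CB.
Qed.

(** Coefficientwise application of a map. It is compatible with the blades when
    the map is odd, as are complex conjugation and multiplication by a scalar. *)
Definition cmap (f : A -> A) s : cliff := Clifford [ffun B : {set 'I_m} => f (s B)].

Arguments cmap : simpl never.

Lemma cmapE f s B : cmap f s B = f (s B). Proof. exact: ffunE. Qed.

Section CoefficientwiseMap.
Variable f : A -> A.
Hypothesis fN : forall a, f (- a) = - f a.

Let f_sign n a : f ((-1) ^+ n * a) = (-1) ^+ n * f a.
Proof. by rewrite -signr_odd; case: (odd n); rewrite ?mul1r ?expr1 ?mulN1r. Qed.

Lemma cmap_blade B s : cmap f (blade A B * s) = blade A B * cmap f s.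
Proof. by apply: clifford_ext => D; rewrite cmapE !blade_mulE f_sign cmapE. Qed.

Lemma cmap_mul_blade B s : cmap f (s * blade A B) = cmap f s * blade A B.
Proof. by apply: clifford_ext => D; rewrite cmapE !mul_bladeE f_sign cmapE. Qed.

Lemma cmap_omega s : cmap f (omega * s) = omega * cmap f s.
Proof. by rewrite omegaE cmap_blade. Qed.

Lemma cmap_alpha s : cmap f (alpha s) = alpha (cmap f s).
Proof. by apply: clifford_ext => D; rewrite !(cmapE, ffunE) f_sign. Qed.

End CoefficientwiseMap.

Lemma cmap_linear f : linear f -> linear (cmap f).
Proof.
move=> f_lin a s t; apply: clifford_ext => B.
by rewrite coefDE coefZE !cmapE coefDE coefZE f_lin.
Qed.

(** The action of a coefficient [a] on the algebra. *)
Definition cmul (a : A) : cliff -> cliff := cmap ( *%R a).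

Arguments cmul : simpl never.

Lemma cmulE a s B : cmul a s B = a * s B. Proof. exact: cmapE. Qed.

Lemma cmul_mulr a s t : cmul a s * t = cmul a (s * t).
Proof.
apply: clifford_ext => D; rewrite cmulE.
have mulE u v : u * v = clifford_mul u v by [].
rewrite !mulE !ffunE mulr_sumr; apply: eq_bigr => B _.
by rewrite cmulE [RHS]mulrCA !mulrA.
Qed.

Lemma cmul_mull a s t : s * cmul a t = cmul a (s * t).
Proof.
apply: clifford_ext => D; rewrite cmulE.
have mulE u v : u * v = clifford_mul u v by [].
rewrite !mulE !ffunE mulr_sumr; apply: eq_bigr => B _.
by rewrite cmulE [RHS]mulrCA [s B * (a * _)]mulrCA.
Qed.

Lemma blade_sum s : s = \sum_B cmul (s B) (blade A B).
Proof.
apply: clifford_ext => D; rewrite coef_sum (bigD1 D) //= big1 => [|B /negPf BD].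
  by rewrite addr0 !ffunE eqxx mulr1.
by rewrite !ffunE eq_sym BD mulr0.
Qed.

(** ** The grading *)

Lemma alphaE s B : alpha s B = (-1) ^+ #|B| * s B. Proof. exact: ffunE. Qed.

Lemma alpha_linear : linear (@alpha R A m).
Proof.
by move=> a s t; apply: clifford_ext => B;
  rewrite coefDE coefZE !alphaE coefDE coefZE mulrDr scalerAr.
Qed.

Lemma alphaK : involutive (@alpha R A m).
Proof.
move=> s; apply: clifford_ext => B.
by rewrite !alphaE mulrA -exprD addnn -signr_odd odd_double mul1r.
Qed.

Let sign_symdiff1 i D : (-1) ^+ #|symdiff [set i] D| = - (-1) ^+ #|D| :> A.
Proof. by rewrite -signr_odd odd_card_symdiff1 signrN signr_odd. Qed.

Lemma alpha_gen i s : alpha (gen i * s) = - (gen i * alpha s).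
Proof.
apply: clifford_ext => D; rewrite coefN alphaE !blade_mulE alphaE.
by rewrite sign_symdiff1 mulrCA mulNr mulrN opprK.
Qed.

Lemma alpha_mul_gen i s : alpha (s * gen i) = - (alpha s * gen i).
Proof.
apply: clifford_ext => D; rewrite coefN alphaE !mul_bladeE alphaE.
by rewrite sign_symdiff1 mulrCA mulNr mulrN opprK.
Qed.

(** ** Products of generators *)

Let lmul_gen (i : 'I_m) s : cliff := gen i * s.

Let lmul_lin i : linear (lmul_gen i).
Proof. by move=> a s t; rewrite /lmul_gen mulrDr scalerAr. Qed.

Lemma gen_sqr i : gen i * gen i = -1 :> cliff.
Proof.
have := gen_anticomm A i i; rewrite eqxx => e.
rewrite -[LHS]half_double e -mulNrn -scaler_nat scalerA.
by rewrite mulVf ?pnatr_eq0 // scale1r.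
Qed.

Lemma gen_swap i j : i != j -> gen i * gen j = - (gen j * gen i) :> cliff.
Proof.
move=> ij; have := gen_anticomm A i j; rewrite (negPf ij) oppr0 mul0rn => /eqP.
by rewrite addr_eq0 => /eqP.
Qed.

Let lmul_sq i s : lmul_gen i (lmul_gen i s) = - s.
Proof. by rewrite /lmul_gen mulrA gen_sqr mulN1r. Qed.

Let lmul_anti i j s : i != j ->
  lmul_gen i (lmul_gen j s) = - lmul_gen j (lmul_gen i s).
Proof. by move=> ij; rewrite /lmul_gen !mulrA gen_swap // mulNr. Qed.

Let prod_lmul (r : seq 'I_m) s : (\prod_(i <- r) gen i) * s = opprod lmul_gen r s.
Proof.
elim: r => [|i r IHr]; first by rewrite big_nil mul1r opprod_nil.
by rewrite big_cons opprod_cons -mulrA IHr.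
Qed.

Let blade_lmul B s : blade A B * s = opprod lmul_gen (enum B) s.
Proof.
by rewrite -blade_prod -prod_lmul [index_enum _]unlock /enum_mem big_filter.
Qed.

Lemma gen_blade_swap i B :
  gen i * blade A B = (-1) ^+ (#|B| + (i \in B)) *: (blade A B * gen i).
Proof.
rewrite -[blade A B in LHS]mulr1 ![blade A B * _]blade_lmul.
rewrite -[LHS]/(lmul_gen i (opprod _ _ _)).
rewrite (opprod_swap lmul_lin lmul_anti) ?enum_uniq // -cardE mem_enum.
by rewrite /lmul_gen mulr1.
Qed.

Lemma gen_omega i : gen i * omega = (-1) ^+ m.+1 *: (omega * gen i) :> cliff.
Proof. by rewrite omegaE gen_blade_swap inE cardsT card_ord addn1. Qed.

Lemma omega_sqr : omega * omega = (-1) ^+ 'C(m.+1, 2) *: 1 :> cliff.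
Proof.
rewrite -[omega in X in _ * X]mulr1 omegaE !blade_lmul.
rewrite (opprod_sqr lmul_lin lmul_sq lmul_anti) ?enum_uniq //.
by rewrite -cardE cardsT card_ord.
Qed.

Lemma alpha_omega s : alpha (omega * s) = (-1) ^+ m *: (omega * alpha s).
Proof.
rewrite omegaE !blade_lmul (opprod_scomm lmul_lin (e := 1) _ alpha_linear).
  by rewrite mul1n -cardE cardsT card_ord.
by move=> i t; rewrite expr1 scaleN1r; apply: alpha_gen.
Qed.

(** ** Operators commuting with the multiplications by generators *)

(** Conjugation by a generator is diagonal in the basis of blades. *)
Lemma gen_conj i u B :
  (gen i * u * gen i) B = - ((-1) ^+ (#|B| + (i \in B)) * u B).
Proof.
rewrite {1}[u]blade_sum mulr_sumr mulr_suml coef_sum.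
rewrite (bigD1 B) // big1 => [|C /andP[_ /negPf CB]];
  rewrite cmul_mull cmul_mulr gen_blade_swap -scalerAl -mulrA gen_sqr mulrN1 cmulE
    coefZE coefN ffunE.
  rewrite [LHS]addr0 eqxx -scalerAr mulrN mulr1 scalerN -signr_odd -[in RHS]signr_odd.
  by case: (odd _); rewrite ?expr1 ?scaleN1r ?scale1r ?mulN1r ?mul1r.
by rewrite eq_sym CB oppr0 scaler0 mulr0.
Qed.

Let coef_eqN a : a = - a -> a = 0 :> A. Proof. exact: lmod_eqN0. Qed.

Let scalar_of_coef u : (forall B, B != set0 -> u B = 0) -> u = cmul (u set0) 1.
Proof.
move=> u0; apply: clifford_ext => B; rewrite cmulE ffunE.
by case: eqP => [->|/eqP/u0->]; rewrite ?mulr1 ?mulr0.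
Qed.

(** In even dimension the centre consists of the scalars: [gen i] commutes with
    the blade of B iff #|B| + (i \in B) is even. *)
Lemma center_scalar u : ~~ odd m -> (forall i, gen i * u = u * gen i) ->
  u = cmul (u set0) 1.
Proof.
move=> m_even comm; apply: scalar_of_coef => B B0; apply: coef_eqN.
have uB i : u B = (-1) ^+ (#|B| + (i \in B)) * u B.
  by apply: oppr_inj; rewrite -gen_conj comm -mulrA gen_sqr mulrN1 coefN.
suff [i odd_i] : exists i, odd (#|B| + (i \in B)).
  by rewrite {1}(uB i) -signr_odd odd_i mulN1r.
have [B_odd|B_even] := boolP (odd #|B|); last first.
  by have /set0Pn[i iB] := B0; exists i; rewrite iB oddD (negPf B_even).
have: B != setT by apply: contraTneq B_odd => ->; rewrite cardsT card_ord.
rewrite -subTset => /subsetPn[i _ iB]; exists i.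
by rewrite (negPf iB) oddD B_odd.
Qed.

(** Here the blade of B contributes the sign (-1) ^+ (i \in B) only, so that no
    assumption on [m] is needed. *)
Lemma twisted_center_scalar u : (forall i, gen i * u = alpha u * gen i) ->
  u = cmul (u set0) 1.
Proof.
move=> comm; apply: scalar_of_coef => B /set0Pn[i iB]; apply: coef_eqN.
have := gen_conj i u B; rewrite comm -mulrA gen_sqr mulrN1 coefN alphaE iB.
move=> /oppr_inj/(congr1 (fun a => (-1) ^+ #|B| * a)); rewrite !mulrA -!exprD addnA.
rewrite addnn exprD -signr_odd odd_double mul1r mul1r.
by rewrite mulN1r.
Qed.

(** An operator that is linear over the coefficients and commutes with the left
    multiplications is a right multiplication. *)
Lemma right_mul_operator (T : cliff -> cliff) : linear T ->
  (forall a s, T (cmul a s) = cmul a (T s)) ->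
  (forall i s, T (gen i * s) = gen i * T s) ->
  forall s, T s = s * T 1.
Proof.
move=> T_lin Tcmul Tgen s.
rewrite {1}[s]blade_sum (lin_sum T_lin) {2}[s]blade_sum mulr_suml.
apply: eq_bigr => B _; rewrite Tcmul cmul_mulr; congr (cmul _ _).
by rewrite -[blade A B in LHS]mulr1 !blade_lmul; apply: opprod_comm.
Qed.

End Clifford.

(** * The scalar product for which the blades are orthonormal *)

Section StandardForm.
Variables (R : rcfType) (A : comAlgType R) (m : nat).
Local Notation cliff := (clifford (R := R) A m).
Implicit Types (s t : cliff) (B D : {set 'I_m}).
Variable q : A -> A -> R.

(** The form [q] on the coefficients, summed over the blades. *)
Definition std_form s t : R := \sum_B q (s B) (t B).

Hypothesis qP : scalar_product q.

Let bq : form_bilinear q. Proof. by case: qP. Qed.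

Lemma std_form_scalar_product : scalar_product std_form.
Proof.
have [_ q_sym q_pos] := qP; split; first split.
- move=> t a s u; rewrite /std_form mulr_sumr -big_split; apply: eq_bigr => B _.
  by rewrite coefDE coefZE formDl // formZl.
- move=> t a s u; rewrite /std_form mulr_sumr -big_split; apply: eq_bigr => B _.
  by rewrite coefDE coefZE formDr // formZr.
- by move=> s t; apply: eq_bigr => B _; apply: q_sym.
move=> s s0; have q_ge0 a : 0 <= q a a.
  by have [->|/q_pos/ltW//] := eqVneq a 0; rewrite form0l.
rewrite lt_def sumr_ge0 // andbT; apply: contra s0 => /eqP h0.
apply/eqP/clifford_ext => B; rewrite coef0; apply/eqP; apply: contraT => /q_pos.
move: h0 => /psumr_eq0P -> //; by rewrite ltxx.
Qed.

Let q_sign n a b : q ((-1) ^+ n * a) ((-1) ^+ n * b) = q a b.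
Proof.
rewrite -signr_odd; case: (odd n); rewrite ?mul1r ?expr1 ?mulN1r //.
by rewrite formNl // formNr // opprK.
Qed.

Let sum_symdiff B (F : {set 'I_m} -> R) : \sum_D F (symdiff B D) = \sum_D F D.
Proof. by rewrite [RHS](reindex_inj (can_inj (symdiffK B))). Qed.

Lemma std_form_blade_mul B s t :
  std_form (blade A B * s) (blade A B * t) = std_form s t.
Proof.
rewrite /std_form -[RHS](sum_symdiff B); apply: eq_bigr => D _.
by rewrite !blade_mulE q_sign.
Qed.

Lemma std_form_mul_blade B s t :
  std_form (s * blade A B) (t * blade A B) = std_form s t.
Proof.
rewrite /std_form -[RHS](sum_symdiff B); apply: eq_bigr => D _.
by rewrite !mul_bladeE q_sign.
Qed.

Lemma std_form_alpha s t : std_form (alpha s) (alpha t) = std_form s t.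
Proof. by apply: eq_bigr => B _; rewrite !alphaE q_sign. Qed.

Lemma std_form_cmap f s t : (forall a b, q (f a) (f b) = q a b) ->
  std_form (cmap f s) (cmap f t) = std_form s t.
Proof. by move=> qf; apply: eq_bigr => B _; rewrite !cmapE qf. Qed.

(** The vector representing a linear form, given one ([repq]) for [q]. *)
Definition std_rep (repq : (A -> R) -> A) (f : cliff -> R) : cliff :=
  Clifford [ffun B : {set 'I_m} => repq (fun a => f (cmul a (blade A B)))].

Lemma std_repP repq : (forall f, scalar f -> forall a, f a = q (repq f) a) ->
  forall f : cliff -> R, scalar f -> forall t, f t = std_form (std_rep repq f) t.
Proof.
move=> repqP f f_lin t; rewrite {1}[t]blade_sum.
rewrite (lin_sum (V := R^o) f_lin); apply: eq_bigr => B _; rewrite ffunE -repqP //.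
move=> k a b; rewrite -f_lin; congr f; apply: clifford_ext => D.
by rewrite coefDE coefZE !cmulE mulrDl scalerAl.
Qed.

End StandardForm.

(** * Symmetry and orthogonality of the forms h(A v s, t) *)

Section InvariantForms.
Variables (R : rcfType) (S : lmodType R) (h : S -> S -> R).
Hypothesis bh : form_bilinear h.

Lemma isometry_adjoint (A : S -> S) (d : nat) :
  (forall s t, h (A s) (A t) = h s t) -> (forall s, A (A s) = (-1) ^+ d *: s) ->
  forall s t, h (A s) t = (-1) ^+ d * h s (A t).
Proof.
move=> A_iso A_sq s t; rewrite -(A_iso s (A t)) A_sq formZr // mulrA -exprD addnn.
by rewrite -signr_odd odd_double mul1r.
Qed.

Variables (n : nat) (cl : 'cV[R]_n -> S -> S).
Hypothesis h_sym : form_symmetric h.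
Hypothesis cl_skew : forall v s t, h (cl v s) t = - h s (cl v t).

(** The symmetry of h(A v s, t): the operator [A] contributes the sign of its
    square and the sign of its commutation with [v], and [v] contributes -1. *)
Lemma jrho_symmetry (A : S -> S) (d e : nat) v s t :
  (forall s t, h (A s) (A t) = h s t) -> (forall s, A (A s) = (-1) ^+ d *: s) ->
  (forall s, A (cl v s) = (-1) ^+ e *: cl v (A s)) ->
  h (A (cl v s)) t = (-1) ^+ (d + e).+1 * h (A (cl v t)) s.
Proof.
move=> A_iso A_sq A_cl; rewrite (isometry_adjoint A_iso A_sq) cl_skew [in RHS]A_cl.
rewrite formZl // h_sym exprS exprD -!mulrA mulN1r mulrN; congr (- (_ * _)).
by rewrite mulrA -exprD addnn -signr_odd odd_double mul1r.
Qed.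

(** The vanishing of h(A v s, t) for [s], [t] in eigenspaces of an isometry [J]
    that anticommutes with [v]. *)
Lemma jrho_vanish (A J : S -> S) (f x y : nat) v s t :
  (forall s t, h (J s) (J t) = h s t) ->
  (forall s, J (A s) = (-1) ^+ f *: A (J s)) ->
  (forall s, J (cl v s) = - cl v (J s)) -> linear A -> linear (cl v) ->
  J s = (-1) ^+ x *: s -> J t = (-1) ^+ y *: t -> ~~ odd (f + x + y) ->
  h (A (cl v s)) t = 0.
Proof.
move=> J_iso JA Jcl A_lin v_lin Js Jt even_fxy.
apply: (@lmod_eqN0 R R^o).
rewrite -[LHS]J_iso JA Jcl Js Jt (linZ v_lin) (linN A_lin) (linZ A_lin).
rewrite scalerN scalerA -exprD -scaleNr formZl // formZr // mulrA mulNr -exprD.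
by rewrite -signr_odd (negPf even_fxy) mulN1r.
Qed.

End InvariantForms.

(** * Forms on spin modules: the abstract argument *)

(** ** Modules whose commutant consists of the real scalars *)

Section RealSpinors.
Variables (R : rcfType) (N : nat) (S : lmodType R) (rho : 'cV[R]_N -> S -> S).

Let cl : 'cV[R]_(1 + N) -> S -> S := extension rho id.

Hypothesis N_even : ~~ odd N.
Hypothesis rho_action : clifford_action rho.
(* The volume element of Cl_N squares to -1. *)
Hypothesis N_sign : odd 'C(N.+1, 2).
Hypothesis schur : forall T : S -> S, linear T ->
  (forall i s, T (rho (delta_mx i 0) s) = rho (delta_mx i 0) (T s)) ->
  exists a : R, forall s, T s = a *: s.

Lemma real_action : clifford_action cl.
Proof.
by apply: extension_action => // s; rewrite -signr_odd /= N_sign scale1r.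
Qed.

Let even_scalar A : even_commutant cl A -> exists a : R, forall s, A s = a *: s.
Proof.
move=> A_even; have [A_lin _] := A_even; apply: schur => //.
by apply: (@extension_even_commutant _ _ _ rho id).
Qed.

Variables (h0 : S -> S -> R) (rep : (S -> R) -> S) (s0 : S).
Hypothesis s0_neq0 : s0 != 0.
Hypothesis h0P : scalar_product h0.
Hypothesis repP : forall f : S -> R, scalar f -> forall t, f t = h0 (rep f) t.
Hypothesis rho_iso : forall i s t,
  h0 (rho (delta_mx i 0) s) (rho (delta_mx i 0) t) = h0 s t.

Let b0 : form_bilinear h0. Proof. by case: h0P. Qed.

Let e_iso i s t : h0 (cl (delta_mx i 0) s) (cl (delta_mx i 0) t) = h0 s t.
Proof. exact: extension_isometry. Qed.

Lemma real_embeddings h : scalar_product h -> clifford_invariant cl h ->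
  [/\ so_embedding cl (jrho cl h), forall v, form_skew (jrho cl h v)
    & forall phi, so_embedding cl phi ->
        exists a : R, forall v s t, phi v s t = a * jrho cl h v s t].
Proof.
move=> hP h_inv; have [bh h_sym h_pos] := hP.
have [B [B_lin hB B_e]] := invariant_form_operator real_action h0P e_iso repP bh h_inv.
have [|x BE] := @even_scalar B; first by split=> // i j s; rewrite !B_e.
have hE s t : h s t = x * h0 s t by rewrite hB BE formZl.
have x_neq0 : x != 0.
  by apply: contraTneq (h_pos _ s0_neq0) => x0; rewrite hE x0 mul0r ltxx.
have h_skew v s t : h (cl v s) t = - h s (cl v t).
  by apply: (isometry_skew real_action bh) => i s' t'; rewrite !hE e_iso.
split.
- apply: (embedding_of_commutant (A := id) real_action hP h_skew) => //.
  by exists s0.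
- by move=> v s t; rewrite /jrho h_skew h_sym.
move=> phi /(equivariant_factor real_action (lshift N ord0) h0P e_iso repP)[A].
case/even_scalar => a AE phiE; exists (a / x) => v s t.
by rewrite phiE AE (formZl b0) /jrho hE mulrA divfK.
Qed.

End RealSpinors.

(** ** Modules with a complex structure I and an antilinear structure map J *)

Section ComplexSpinors.
Variables (R : rcfType) (N : nat) (S : lmodType R) (rho : 'cV[R]_N -> S -> S).
Variables (I J : S -> S) (o : bool) (d : nat).

(** The additional vector acts as the volume element if [o], and as [I] composed
    with it otherwise. *)
Let P (s : S) : S := if o then s else I s.
Let K (s : S) : S := I (J s).
Let cl : 'cV[R]_(1 + N) -> S -> S := extension rho P.
Let G i : S -> S := rho (delta_mx i 0).

Hypothesis N_even : ~~ odd N.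
Hypothesis rho_action : clifford_action rho.
(* The volume element of Cl_N squares to -1 if [o], and to 1 otherwise. *)
Hypothesis P_sign : odd 'C(N.+1, 2) = o.
(* If [o], then [J] commutes with all vectors; it then has to be a quaternionic
   structure for the invariant scalar product to be unique. *)
Hypothesis d_odd : o -> odd d.
Hypotheses (I_lin : linear I) (J_lin : linear J).
Hypothesis I_sq : forall s, I (I s) = - s.
Hypothesis J_sq : forall s, J (J s) = (-1) ^+ d *: s.
Hypothesis JI : forall s, J (I s) = - I (J s).
Hypothesis I_rho : forall i s, I (rho (delta_mx i 0) s) = rho (delta_mx i 0) (I s).
Hypothesis J_rho : forall i s,
  J (rho (delta_mx i 0) s) = (-1) ^+ (~~ o) *: rho (delta_mx i 0) (J s).
(** The complex linear commutant of [rho] consists of the complex scalars. *)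
Hypothesis schur : forall T : S -> S, linear T -> (forall s, T (I s) = I (T s)) ->
  (forall i s, T (rho (delta_mx i 0) s) = rho (delta_mx i 0) (T s)) ->
  exists a b : R, forall s, T s = a *: s + b *: I s.

Let ID s t : I (s + t) = I s + I t. Proof. exact: linD. Qed.
Let IN s : I (- s) = - I s. Proof. exact: linN. Qed.
Let IZ a s : I (a *: s) = a *: I s. Proof. exact: linZ. Qed.
Let JD s t : J (s + t) = J s + J t. Proof. exact: linD. Qed.
Let JN s : J (- s) = - J s. Proof. exact: linN. Qed.
Let JZ a s : J (a *: s) = a *: J s. Proof. exact: linZ. Qed.
Let G_lin i : linear (G i). Proof. by case: rho_action => _ + _ _; apply. Qed.
Let GD i s t : G i (s + t) = G i s + G i t. Proof. exact: linD. Qed.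
Let GN i s : G i (- s) = - G i s. Proof. exact: linN. Qed.

Let I_G i s : I (G i s) = G i (I s). Proof. exact: I_rho. Qed.
Let J_G i s : J (G i s) = (-1) ^+ (~~ o) *: G i (J s). Proof. exact: J_rho. Qed.

Let P_lin : linear P. Proof. by rewrite /P; case: o. Qed.

Let P_comm i s : P (rho (delta_mx i 0) s) = rho (delta_mx i 0) (P s).
Proof. by rewrite /P; case: o. Qed.

Lemma complex_action : clifford_action cl.
Proof.
apply: extension_action => // s; rewrite -signr_odd /= P_sign /P.
by case: o; rewrite ?scale1r // I_sq scaleN1r.
Qed.

Let cl_lin v : linear (cl v). Proof. by case: complex_action. Qed.

Let K_lin : linear K. Proof. by move=> a s t; rewrite /K J_lin I_lin. Qed.

Let K_sq s : K (K s) = (-1) ^+ d *: s.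
Proof. by rewrite /K JI IN I_sq opprK J_sq. Qed.

Let I_e i s : I (cl (delta_mx i 0) s) = (-1) ^+ 0 *: cl (delta_mx i 0) (I s).
Proof.
apply: extension_scomm => // [j t|t]; rewrite scale1r // /P.
by case: o.
Qed.

Let J_e i s : J (cl (delta_mx i 0) s) = (-1) ^+ (~~ o) *: cl (delta_mx i 0) (J s).
Proof.
by apply: extension_scomm => // t; rewrite /P; case: o; rewrite ?scale1r // JI scaleN1r.
Qed.

Let K_e i s : K (cl (delta_mx i 0) s) = (-1) ^+ (~~ o) *: cl (delta_mx i 0) (K s).
Proof. by rewrite /K J_e IZ I_e scale1r. Qed.

Let scomm_vector (A : S -> S) (e : nat) : linear A ->
  (forall i s, A (cl (delta_mx i 0) s) = (-1) ^+ e *: cl (delta_mx i 0) (A s)) ->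
  forall v s, A (cl v s) = (-1) ^+ e *: cl v (A s).
Proof.
have [cl_l _ _ _] := complex_action => A_lin A_e v s.
rewrite (cl_coord v (cl_l s)) (cl_coord v (cl_l (A s))) (lin_sum A_lin) scaler_sumr.
by apply: eq_bigr => i _; rewrite (linZ A_lin) A_e scalerA mulrC -scalerA.
Qed.

Let I_cl v s : I (cl v s) = (-1) ^+ 0 *: cl v (I s). Proof. exact: scomm_vector. Qed.
Let J_cl v s : J (cl v s) = (-1) ^+ (~~ o) *: cl v (J s).
Proof. exact: scomm_vector. Qed.
Let K_cl v s : K (cl v s) = (-1) ^+ (~~ o) *: cl v (K s).
Proof. exact: scomm_vector. Qed.

(** The commutant of the even subalgebra is spanned by Id, I, J, K. The part of
    [A] that is complex linear commutes with [rho]; the part that is antilinear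
    does so once it is composed with [J]. *)
Lemma even_commutant_span A : even_commutant cl A ->
  exists a b c k : R, forall s, A s = a *: s + b *: I s + c *: J s + k *: K s.
Proof.
move=> A_even; have [A_lin _] := A_even.
have AN s : A (- s) = - A s by exact: linN.
have APG i s : A (P (G i s)) = P (G i (A s)).
  by apply: (@extension_even_commutant _ _ _ rho).
have AG i s : A (G i s) = if o then G i (A s) else - G i (I (A (I s))).
  move: APG; rewrite /P; case: o => [//|APG].
  by rewrite -[LHS]opprK -AN -GN -I_sq -I_G APG I_G.
have IAIG i s : I (A (I (G i s))) = if o then G i (I (A (I s))) else - G i (A s).
  move: APG AG; rewrite /P; case: o => APG AG; first by rewrite I_G AG I_G.
  by rewrite APG I_sq.
(* twice the linear and twice the antilinear part of [A] *)
pose A1 s := A s - I (A (I s)); pose A2 s := A s + I (A (I s)).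
have IAI_lin : linear (fun s => I (A (I s))).
  by move=> a s t; rewrite I_lin A_lin I_lin.
have A1_lin : linear A1.
  by move=> a s t; rewrite /A1 A_lin IAI_lin scalerBr opprD addrACA.
have A2_lin : linear A2.
  by move=> a s t; rewrite /A2 A_lin IAI_lin scalerDr addrACA.
have A1_I s : A1 (I s) = I (A1 s).
  by rewrite /A1 I_sq AN !(ID, IN) I_sq !opprK addrC.
have A2_I s : A2 (I s) = - I (A2 s).
  by rewrite /A2 I_sq AN !(ID, IN) I_sq opprD opprK addrC.
have A1_G i s : A1 (G i s) = G i (A1 s).
  rewrite /A1 AG IAIG GD GN; case: o => //; by rewrite opprK addrC.
have A2_G i s : A2 (G i s) = (-1) ^+ (~~ o) *: G i (A2 s).
  rewrite /A2 AG IAIG GD; case: o; rewrite ?scale1r //.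
  by rewrite scaleN1r opprD addrC.
have [a [b A1E]] := schur A1_lin A1_I A1_G.
have [||i s|c [k TE]] := schur (T := J \o A2).
- by move=> x s t /=; rewrite A2_lin J_lin.
- by move=> s /=; rewrite A2_I JN JI opprK.
- rewrite /= -/(G i s) A2_G JZ J_G scalerA -exprD addnn.
  by rewrite -signr_odd odd_double scale1r.
exists (2^-1 * a), (2^-1 * b), (2^-1 * ((-1) ^+ d * c)), (- (2^-1 * ((-1) ^+ d * k))).
have A2E s : A2 s = (-1) ^+ d *: (c *: J s - k *: K s).
  rewrite -scalerN -JI -!JZ -JD -TE /= J_sq scalerA -exprD addnn.
  by rewrite -signr_odd odd_double scale1r.
move=> s; rewrite -[LHS]half_double.
have -> : A s + A s = A1 s + A2 s by rewrite /A1 /A2 addrACA addNr addr0.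
rewrite A1E A2E !scalerDr !scalerA -!addrA; congr (_ + (_ + (_ + _))).
  by rewrite mulrA.
by rewrite scalerN scalerA scaleNr mulrA.
Qed.

Variables (h0 : S -> S -> R) (rep : (S -> R) -> S) (s0 : S).
Hypothesis s0_neq0 : s0 != 0.
Hypothesis h0P : scalar_product h0.
Hypothesis repP : forall f : S -> R, scalar f -> forall t, f t = h0 (rep f) t.
Hypothesis rho_iso : forall i s t,
  h0 (rho (delta_mx i 0) s) (rho (delta_mx i 0) t) = h0 s t.
Hypothesis I_iso : forall s t, h0 (I s) (I t) = h0 s t.
Hypothesis J_iso : forall s t, h0 (J s) (J t) = h0 s t.

Let b0 : form_bilinear h0. Proof. by case: h0P. Qed.
Let h0_sym : form_symmetric h0. Proof. by case: h0P. Qed.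

Let e_iso i s t : h0 (cl (delta_mx i 0) s) (cl (delta_mx i 0) t) = h0 s t.
Proof.
by apply: extension_isometry => // s' t'; rewrite /P; case: o.
Qed.

Let K_iso s t : h0 (K s) (K t) = h0 s t. Proof. by rewrite I_iso J_iso. Qed.

Let I_skew s t : h0 (I s) t = - h0 s (I t).
Proof.
rewrite (isometry_adjoint (d := 1) b0 I_iso) ?expr1 ?mulN1r // => u.
by rewrite I_sq scaleN1r.
Qed.

(** Invariance determines the scalar product up to a factor: its operator [B]
    with respect to [h0] is a real scalar plus a part [Q] that is both symmetric
    and skew. *)
Lemma invariant_form_unique h : scalar_product h -> clifford_invariant cl h ->
  exists2 a : R, a != 0 & forall s t, h s t = a * h0 s t.
Proof.
move=> hP h_inv; have [bh h_sym h_pos] := hP.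
have [_ _ e_sq _] := complex_action.
have [B [B_lin hB B_e]] :=
  invariant_form_operator complex_action h0P e_iso repP bh h_inv.
have [|a [b [c [k BE]]]] := @even_commutant_span B.
  by split=> // i j s; rewrite !B_e.
pose Q s := b *: I s + c *: J s + k *: K s.
have BQ s : B s = a *: s + Q s by rewrite BE /Q !addrA.
have Q_skew s t : h0 (Q s) t = - h0 s (Q t).
  have [o_true|/negPf o_false] := boolP o.
    have JK_skew A : (forall s t, h0 (A s) (A t) = h0 s t) ->
        (forall s, A (A s) = (-1) ^+ d *: s) -> forall s t, h0 (A s) t = - h0 s (A t).
      move=> A_iso A_sq s' t'; rewrite (isometry_adjoint b0 A_iso A_sq).
      by rewrite -signr_odd d_odd // mulN1r.
    rewrite /Q !(formDl b0, formDr b0) !(formZl b0, formZr b0) I_skew.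
    by rewrite (JK_skew J) // (JK_skew K) // !mulrN !opprD.
  (* [J] and [K] anticommute with the additional vector, [B] commutes with it *)
  have JK0 s' : c *: J s' + k *: K s' = 0.
    pose e0 := cl (delta_mx (lshift N 0) 0).
    pose L u := c *: J u + k *: K u.
    have e0D u w : e0 (u + w) = e0 u + e0 w by exact: (linD (cl_lin _)).
    have e0Z x u : e0 (x *: u) = x *: e0 u by exact: (linZ (cl_lin _)).
    have L_e0 u : L (e0 u) = - e0 (L u).
      by rewrite /L J_e K_e o_false !scaleN1r e0D !e0Z !scalerN opprD.
    suff Le0 u : L (e0 u) = 0.
      by rewrite -[s']opprK -(e_sq (lshift N 0)); apply: Le0.
    apply: lmod_eqN0; rewrite {2}L_e0 opprK.
    have := B_e (lshift N 0) u; rewrite -/e0 !BE -!addrA -!/(L _) !e0D !e0Z.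
    by rewrite [I (e0 u)]I_e scale1r => /addrI/addrI.
  by rewrite /Q -!addrA !JK0 !addr0 (formZl b0) (formZr b0) I_skew mulrN.
have hE s t : h s t = a * h0 s t.
  have Q0 : Q s = 0.
    apply: (scalar_product_inj h0P) => u; rewrite (form0l b0).
    apply: (@lmod_eqN0 R R^o); rewrite [LHS]Q_skew; congr (- _).
    have := h_sym s u; rewrite !hB !BQ !(formDl b0 (_ *: _) (Q _)).
    rewrite ![h0 (a *: _) _](formZl b0) [h0 u s]h0_sym.
    by move=> /addrI Qsu; rewrite Qsu [RHS]h0_sym.
  by rewrite hB BQ Q0 addr0 (formZl b0).
exists a => //; apply: contraTneq (h_pos _ s0_neq0) => a0.
by rewrite hE a0 mul0r ltxx.
Qed.

Section InvariantForm.
Variable h : S -> S -> R.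
Hypothesis hP : scalar_product h.
Hypothesis h_inv : clifford_invariant cl h.

Let bh : form_bilinear h. Proof. by case: hP. Qed.
Let h_sym : form_symmetric h. Proof. by case: hP. Qed.

Let h_isometry (A : S -> S) : (forall s t, h0 (A s) (A t) = h0 s t) ->
  forall s t, h (A s) (A t) = h s t.
Proof.
by have [a _ hE] := invariant_form_unique hP h_inv => A_iso s t; rewrite !hE A_iso.
Qed.

Let h_skew v s t : h (cl v s) t = - h s (cl v t).
Proof. by apply: (isometry_skew complex_action bh) => i; apply: h_isometry. Qed.

Let j (A : S -> S) : 'cV[R]_(1 + N) -> S -> S -> R :=
  jrho cl (fun s t => h (A s) t).

Let embedding (A : S -> S) e k : linear A ->
  (forall i s, A (cl (delta_mx i 0) s) = (-1) ^+ e *: cl (delta_mx i 0) (A s)) ->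
  (forall s, A (A s) = (-1) ^+ k *: s) -> so_embedding cl (j A).
Proof.
move=> A_lin A_e A_sq.
apply: (embedding_of_commutant complex_action) => // [|s As0|]; last by exists s0.
  exact: (even_commutant_scomm complex_action A_lin A_e).
have /eqP := A_sq s; rewrite As0 (lin0 A_lin) eq_sym scaler_eq0 signr_eq0.
by move/eqP.
Qed.

Lemma complex_embeddings :
  [/\ so_embedding cl (j id), so_embedding cl (j I),
      so_embedding cl (j J) & so_embedding cl (j K)].
Proof.
split.
- by apply: (@embedding _ 0 0) => // *; rewrite scale1r.
- by apply: (@embedding _ 0 1) => // s; rewrite I_sq scaleN1r.
- exact: (@embedding _ (~~ o) d).
- exact: (@embedding _ (~~ o) d).
Qed.

Lemma complex_embedding_span phi : so_embedding cl phi ->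
  exists a b c k : R, forall v s t,
    phi v s t = a * j id v s t + b * j I v s t + c * j J v s t + k * j K v s t.
Proof.
have [x x_neq0 hE] := invariant_form_unique hP h_inv.
case/(equivariant_factor complex_action (lshift N ord0) h0P e_iso repP) => A.
case/even_commutant_span => a [b [c [k AE]]] phiE.
exists (a / x), (b / x), (c / x), (k / x) => v s t.
rewrite phiE AE !(formDl b0) !(formZl b0) /j /jrho !hE.
by rewrite !mulrA !divfK.
Qed.

(** The symmetry of the four families of forms. *)
Lemma complex_symmetry v :
  [/\ form_skew (j id v), form_symmetric (j I v),
      forall s t, j J v s t = (-1) ^+ (d + ~~ o).+1 * j J v t s
    & forall s t, j K v s t = (-1) ^+ (d + ~~ o).+1 * j K v t s].
Proof.
split=> s t; rewrite /j /jrho.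
- rewrite (jrho_symmetry bh h_sym h_skew (A := id) (d := 0) (e := 0)) ?mulN1r // => u;
    exact/esym/scale1r.
- rewrite (jrho_symmetry bh h_sym h_skew (A := I) (d := 1) (e := 0)) //.
  + by rewrite expr2 mulN1r opprK mul1r.
  + exact: h_isometry.
  + by move=> u; rewrite I_sq scaleN1r.
- apply: (jrho_symmetry bh h_sym h_skew) => //; exact: h_isometry.
- apply: (jrho_symmetry bh h_sym h_skew) => //; exact: h_isometry.
Qed.

(** When [J] anticommutes with vectors, the forms for Id and [J] vanish on
    eigenvectors of [J] to the same eigenvalue, the forms for [I] and [K] on
    eigenvectors to opposite eigenvalues. *)
Lemma complex_eigenspaces v (x y : nat) s t : ~~ o ->
  J s = (-1) ^+ x *: s -> J t = (-1) ^+ y *: t ->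
  (~~ odd (x + y) -> j id v s t = 0 /\ j J v s t = 0) /\
  (odd (x + y) -> j I v s t = 0 /\ j K v s t = 0).
Proof.
move=> /negPf o_false Js Jt.
have JJ := h_isometry J_iso.
have Jcl u : J (cl v u) = - cl v (J u) by rewrite J_cl o_false scaleN1r.
split=> xy; split; rewrite /j /jrho.
- apply: (jrho_vanish bh (A := id) (f := 0) JJ _ Jcl _ (cl_lin v) Js Jt) => // u.
  by rewrite scale1r.
- apply: (jrho_vanish bh (A := J) (f := 0) JJ _ Jcl _ (cl_lin v) Js Jt) => // u.
  by rewrite scale1r.
- apply: (jrho_vanish bh (A := I) (f := 1) JJ _ Jcl _ (cl_lin v) Js Jt) => // [u|].
    by rewrite JI scaleN1r.
  by rewrite -addnA oddD xy.
- apply: (jrho_vanish bh (A := K) (f := 1) JJ _ Jcl _ (cl_lin v) Js Jt) => // [u|].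
    by rewrite /K JI scaleN1r.
  by rewrite -addnA oddD xy.
Qed.

End InvariantForm.
End ComplexSpinors.

(** * Clifford multiplication of R^m + R^m on the Clifford algebra of R^m *)

Section DoubledAction.
Variables (R : rcfType) (A : comAlgType R) (m : nat).
Local Notation cliff := (clifford (R := R) A m).
Variables (w : cliff) (b : bool) (rho : 'cV[R]_(m + m) -> cliff -> cliff).
Implicit Types s t : cliff.

(** The second summand acts by s -> w (tau s) x, where [tau] is the grading
    operator if [b] holds and the identity otherwise. *)
Let tau s : cliff := if b then alpha s else s.

Hypothesis rhoE : forall x s,
  rho x s = vec (usubmx x) * s + w * (if b then alpha s else s) * vec (dsubmx x).
Hypothesis w_tau : forall s, w * (if b then alpha (w * s) else w * s) =
  (-1) ^+ b *: (if b then alpha s else s).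
Hypothesis w_gen : forall i, w * gen i = (-1) ^+ (~~ b) *: (gen i * w).

Let tauK s : tau (tau s) = s.
Proof. by rewrite /tau; case: b; rewrite ?alphaK. Qed.

Let tau_lin : linear tau.
Proof. by rewrite /tau; case: b => // a s t; apply: alpha_linear. Qed.

Let tau_gen i s : tau (gen i * s) = (-1) ^+ b *: (gen i * tau s).
Proof. by rewrite /tau; case: b; rewrite ?scale1r // alpha_gen scaleN1r. Qed.

Let tau_mul_gen i s : tau (s * gen i) = (-1) ^+ b *: (tau s * gen i).
Proof. by rewrite /tau; case: b; rewrite ?scale1r // alpha_mul_gen scaleN1r. Qed.

Let w_tauE s : w * tau (w * s) = (-1) ^+ b *: tau s. Proof. exact: w_tau. Qed.

Lemma vec_linear : linear (vec : 'cV[R]_m -> cliff).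
Proof.
move=> a x y; rewrite /vec scaler_sumr -big_split; apply: eq_bigr => i _.
by rewrite !mxE scalerDl scalerA.
Qed.

Lemma vec_delta i : vec (delta_mx i 0) = gen i :> cliff.
Proof.
rewrite /vec (bigD1 i) //= big1 => [|j /negPf ji]; rewrite mxE ?eqxx ?ji.
  by rewrite addr0 scale1r.
by rewrite scale0r.
Qed.

Let usub_l i : usubmx (delta_mx (lshift m i) 0 : 'cV[R]_(m + m)) = delta_mx i 0.
Proof. by apply/colP => j; rewrite !mxE eq_lshift. Qed.
Let usub_r i : usubmx (delta_mx (rshift m i) 0 : 'cV[R]_(m + m)) = 0.
Proof. by apply/colP => j; rewrite !mxE eq_lrshift. Qed.
Let dsub_l i : dsubmx (delta_mx (lshift m i) 0 : 'cV[R]_(m + m)) = 0.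
Proof. by apply/colP => j; rewrite !mxE eq_rlshift. Qed.
Let dsub_r i : dsubmx (delta_mx (rshift m i) 0 : 'cV[R]_(m + m)) = delta_mx i 0.
Proof. by apply/colP => j; rewrite !mxE eq_rshift. Qed.

Let vec0 : vec (0 : 'cV[R]_m) = 0 :> cliff. Proof. exact: (lin0 vec_linear). Qed.

Lemma doubled_lshift i s : rho (delta_mx (lshift m i) 0) s = gen i * s.
Proof. by rewrite rhoE usub_l dsub_l vec_delta vec0 mulr0 addr0. Qed.

Lemma doubled_rshift i s : rho (delta_mx (rshift m i) 0) s =
  w * (if b then alpha s else s) * gen i.
Proof. by rewrite rhoE usub_r dsub_r vec_delta vec0 mul0r add0r. Qed.

Let rshiftE i s : rho (delta_mx (rshift m i) 0) s = w * tau s * gen i.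
Proof. exact: doubled_rshift. Qed.

Let sign_sqr n s : (-1) ^+ n *: ((-1) ^+ n *: s) = s.
Proof. by rewrite scalerA -exprD addnn -signr_odd odd_double scale1r. Qed.

Let rshift2 i j s : w * tau (w * tau s * gen j) * gen i = s * gen j * gen i.
Proof.
by rewrite tau_mul_gen -scalerAr mulrA w_tauE tauK -!scalerAl sign_sqr.
Qed.

Let lrshift i j s :
  w * tau (gen i * s) * gen j = - (gen i * (w * tau s * gen j)).
Proof.
rewrite tau_gen -scalerAr [w * (_ * _)]mulrA w_gen -!scalerAl scalerA -exprD.
have -> : (-1) ^+ (b + ~~ b) = -1 :> R by case: b.
by rewrite scaleN1r !mulrA.
Qed.

Lemma doubled_action : clifford_action rho.
Proof.
split.
- move=> s a x y; rewrite !rhoE !linearP !vec_linear /= mulrDl mulrDr scalerDr.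
  by rewrite -scalerAl -scalerAr addrACA.
- move=> x a s t; rewrite !rhoE -!/(tau _) tau_lin !mulrDr mulrDl scalerDr.
  by rewrite -!scalerAr -scalerAl addrACA.
- move=> i s; case: (split_ordP i) => i' ->.
    by rewrite !doubled_lshift mulrA gen_sqr mulN1r.
  by rewrite !rshiftE rshift2 -mulrA gen_sqr mulrN1.
- move=> i j s; case: (split_ordP i) => i' ->; case: (split_ordP j) => j' -> ij.
  + rewrite eq_lshift in ij.
    by rewrite !doubled_lshift !mulrA gen_swap // mulNr.
  + by rewrite !doubled_lshift !rshiftE lrshift opprK.
  + by rewrite !doubled_lshift !rshiftE lrshift.
  + rewrite eq_rshift eq_sym in ij.
    by rewrite !rshiftE !rshift2 -!mulrA gen_swap // mulrN.
Qed.

Lemma doubled_isometry q : scalar_product q ->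
  (forall s t, std_form q (w * s) (w * t) = std_form q s t) ->
  forall i s t,
    std_form q (rho (delta_mx i 0) s) (rho (delta_mx i 0) t) = std_form q s t.
Proof.
move=> qP w_iso i s t; case: (split_ordP i) => i' ->.
  by rewrite !doubled_lshift std_form_blade_mul.
rewrite !rshiftE std_form_mul_blade // w_iso /tau; case: b => //.
exact: std_form_alpha.
Qed.

(** Operators that commute with [rho] are scalar: they are right multiplications
    because of the first summand, by a (twisted) central element because of the
    second one. *)
Lemma doubled_schur (T : cliff -> cliff) : (~~ b -> ~~ odd m) -> linear T ->
  (forall a s, T (cmul a s) = cmul a (T s)) ->
  (forall i s, T (rho (delta_mx i 0) s) = rho (delta_mx i 0) (T s)) ->
  exists a : A, forall s, T s = cmul a s.
Proof.
move=> b_even T_lin T_cmul T_rho.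
have T_mul s : T s = s * T 1.
  apply: right_mul_operator => // i t.
  by have := T_rho (lshift m i) t; rewrite !doubled_lshift.
(* left multiplication by [w] is injective by [w_tau] *)
have w_inj s t : w * s = w * t -> s = t.
  move=> st; have := w_tauE s; rewrite st w_tauE.
  by move=> /(can_inj (sign_sqr b))/(can_inj tauK).
have tau1 : tau 1 = 1.
  rewrite /tau; case: b => //; apply: clifford_ext => B; rewrite alphaE ffunE.
  by case: eqP => [->|_]; rewrite ?mulr0 // cards0 mul1r.
have T1_comm i : gen i * T 1 = tau (T 1) * gen i.
  apply: w_inj; rewrite !mulrA -rshiftE -T_rho rshiftE tau1 mulr1.
  by rewrite [RHS]T_mul.
exists (T 1 set0) => s; rewrite T_mul.
have T1E : T 1 = cmul (T 1 set0) 1.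
  move: T1_comm b_even; rewrite /tau; case: b => [comm _|comm b_even].
    exact: twisted_center_scalar.
  by apply: center_scalar; first exact: b_even.
by rewrite {1}T1E cmul_mull mulr1.
Qed.

End DoubledAction.

(** * The spin modules of the model *)

(** The sign of the square of the volume element of Cl_n. *)
Lemma odd_bin2 n : odd 'C(n.+1, 2) = (n %% 4 \in [:: 1; 2])%N.
Proof.
have step k : odd 'C(k.+4.+1, 2) = odd 'C(k.+1, 2).
  by rewrite !(binS _ 1) !bin1 !oddD /=; case: (odd k); case: (odd 'C(k, 2)).
rewrite {1}(divn_eq n 4); elim: (n %/ 4)%N => [|q IHq].
  rewrite mul0n add0n; have := ltn_pmod n (isT : 0 < 4)%N.
  by case: (n %% 4)%N => [|[|[|[]]]].
by rewrite mulSn -addnA step IHq.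
Qed.

Lemma odd_bin2_double n : odd 'C((n + n).+1, 2) = odd n.
Proof.
elim: n => [|n IHn]; first by [].
rewrite addSn addnS (binS _ 1) (binS _ 1) !bin1; move: IHn.
move: 'C((n + n).+1, 2) => c cE; rewrite !oddD cE /= oddD addbb.
by case: (odd n).
Qed.

(** ** The case m = 3 mod 4 *)

Section RealSpinModule.
Variables (R : rcfType) (m : nat).
Hypothesis m3 : (m %% 4 = 3)%N.

Let m_odd : odd m.
Proof. by rewrite (divn_eq m 4) m3 oddD oddM andbF. Qed.

Let q (x y : R^o) : R := x * y.

Let qP : scalar_product q.
Proof.
split; first split.
- by move=> t a x y; rewrite /q mulrDl -mulrA.
- by move=> t a x y; rewrite /q mulrDr mulrCA.
- by move=> x y; rewrite /q mulrC.
- by move=> x x0; rewrite /q -expr2 exprn_even_gt0.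
Qed.

Let repq (f : R^o -> R) : R^o := f 1.

Let repqP f : scalar f -> forall a, f a = q (repq f) a.
Proof.
move=> f_lin a; rewrite /q /repq mulrC -{1}[a]mulr1.
exact: (linZ (V := R^o) f_lin a 1).
Qed.

Let cmulZ a (s : Cl R m) : cmul a s = a *: s.
Proof. by apply: clifford_ext => B; rewrite !ffunE. Qed.

Let real_rhoE x (s : Cl R m) : rho_real x s =
  vec (usubmx x) * s + omega * alpha s * vec (dsubmx x).
Proof. by []. Qed.

Let real_tau (s : Cl R m) : omega * alpha (omega * s) = (-1) ^+ true *: alpha s.
Proof.
rewrite alpha_omega -scalerAr mulrA omega_sqr -scalerAl mul1r scalerA -exprD.
by rewrite -[in LHS]signr_odd oddD m_odd odd_bin2 m3.
Qed.

Let real_gen i : omega * gen i = (-1) ^+ false *: (gen i * omega) :> Cl R m.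
Proof. by rewrite gen_omega scale1r -signr_odd /= m_odd scale1r. Qed.

Lemma real_spin_embeddings (h : Cl R m -> Cl R m -> R) :
  scalar_product h -> clifford_invariant (@trho_real R m) h ->
  [/\ so_embedding (@trho_real R m) (jrho (@trho_real R m) h),
      forall v, form_skew (jrho (@trho_real R m) h v)
    & forall phi, so_embedding (@trho_real R m) phi ->
        exists a : R, forall v s t,
          phi v s t = a * jrho (@trho_real R m) h v s t].
Proof.
apply: (@real_embeddings _ _ _ (@rho_real R m) _ _ _ _ (std_form q)
  (std_rep repq) 1).
- by rewrite addnn odd_double.
- exact: (doubled_action (b := true) real_rhoE real_tau real_gen).
- by rewrite odd_bin2_double.
- move=> T T_lin T_rho.
  have [||a Ta] := doubled_schur (b := true) real_rhoE real_tau _ T_lin _ T_rho.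
  + by [].
  + by move=> a s; rewrite !cmulZ (linZ T_lin).
  by exists a => s; rewrite Ta cmulZ.
- exact: oner_neq0.
- exact: std_form_scalar_product.
- exact: std_repP.
- apply: (doubled_isometry (b := true) real_rhoE) => // s t.
  by rewrite omegaE std_form_blade_mul.
Qed.

End RealSpinModule.

(** ** The case m = 0, 1, 2 mod 4 *)

Section ComplexSpinModule.
Variables (R : rcfType) (m : nat).
Local Notation C := (Rcomplex R).
Local Notation S := (CCl R m).
Local Notation I := (@opI R m).
Local Notation J := (@opJ R m).
Implicit Types s t : S.

(* The Euclidean scalar product of the complex plane. *)
Let q (x y : C) : R := complex.Re x * complex.Re y + complex.Im x * complex.Im y.

Let qP : scalar_product q.
Proof.
split; first split.
- by move=> [c d] a [x y] [z u]; rewrite /q /=; ring.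
- by move=> [c d] a [x y] [z u]; rewrite /q /=; ring.
- by move=> [x y] [z u]; rewrite /q /=; ring.
- move=> [x y] xy0; rewrite /q /= -!expr2 lt_def addr_ge0 ?sqr_ge0 // andbT.
  by rewrite paddr_eq0 ?sqr_ge0 // !sqrf_eq0; move: xy0; rewrite eq_complex.
Qed.

Let repq (f : C -> R) : C := (f 1 +i* f 'i)%C.

Let repqP f : scalar f -> forall a, f a = q (repq f) a.
Proof.
move=> f_lin [x y]; have fD := linD (V := R^o) f_lin.
have fZ := linZ (V := R^o) f_lin.
have -> : (x +i* y)%C = x *: (1 : C) + y *: ('i%C : C) :> C.
  by apply/eqP; rewrite eq_complex /= !(mulr0, mulr1, addr0, add0r) !eqxx.
rewrite fD !fZ /q /= !(mulr0, mulr1, addr0, add0r).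
by rewrite [f 1 * _]mulrC [f _ * y]mulrC.
Qed.

Let h0 : S -> S -> R := std_form q.

(** *** The complex structure *)

Let opIE s : I s = cmul ('i%C : C) s. Proof. by []. Qed.

Let opI_lin : linear I.
Proof.
by apply: cmap_linear => a x y; rewrite mulrDr scalerAr.
Qed.

Let opI_sq s : I (I s) = - s.
Proof.
apply: clifford_ext => B; rewrite coefN !opIE !cmulE.
case: (s B) => x y; apply/eqP; rewrite eq_complex /=.
by apply/andP; split; apply/eqP; ring.
Qed.

Let opI_mul s t : I (s * t) = I s * t. Proof. by rewrite !opIE cmul_mulr. Qed.
Let opI_mulr s t : I (s * t) = s * I t. Proof. by rewrite !opIE cmul_mull. Qed.
Let opI_alpha s : I (alpha s) = alpha (I s).
Proof. by rewrite !opIE -cmap_alpha // => a; rewrite mulrN. Qed.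

Let cmulE' (a : C) s : cmul a s = complex.Re a *: s + complex.Im a *: I s.
Proof.
apply: clifford_ext => B; rewrite coefDE !coefZE opIE !cmulE.
case: a => x y; case: (s B) => z u.
apply/eqP; rewrite eq_complex /=; apply/andP; split; apply/eqP; ring.
Qed.

Let opI_iso s t : h0 (I s) (I t) = h0 s t.
Proof.
apply: std_form_cmap => -[x y] [z u]; rewrite /q /=; ring.
Qed.

(** *** The action of R^(2m) *)

Let b : bool := (m %% 4 != 0)%N.
(* The action of the second summand is s -> i alpha(s) x, or s -> omega s x if
   m = 0 mod 4. *)
Let w : S := if b then I 1 else omega.

Let m_even : ~~ b -> ~~ odd m.
Proof.
by rewrite negbK => /eqP m0; rewrite (divn_eq m 4) m0 oddD oddM andbF.
Qed.

Let complex_rhoE x s : rho_complex x s =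
  vec (usubmx x) * s + w * (if b then alpha s else s) * vec (dsubmx x).
Proof.
rewrite /rho_complex /w /b; case: (m %% 4 == 0)%N => //=.
by rewrite -!opI_mul mul1r.
Qed.

Let complex_tau s : w * (if b then alpha (w * s) else w * s) =
  (-1) ^+ b *: (if b then alpha s else s).
Proof.
have m0 := m_even; rewrite /w; case: ifP m0 => [_ _|/negbT b0 _].
  by rewrite -!opI_mul !mul1r -opI_alpha opI_sq scaleN1r.
rewrite mulrA omega_sqr -signr_odd odd_bin2.
by move: b0; rewrite negbK => /eqP ->; rewrite /= -scalerAl mul1r.
Qed.

Let complex_gen i : w * gen i = (-1) ^+ (~~ b) *: (gen i * w).
Proof.
have m0 := m_even; rewrite /w; case: ifP m0 => [_ _|/negbT b0 m0].
  by rewrite -opI_mul -opI_mulr mul1r mulr1 scale1r.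
rewrite gen_omega -(signr_odd _ m.+1) /= (negPf (m0 isT)) scalerA.
by rewrite mulN1r opprK scale1r.
Qed.

Let w_iso s t : h0 (w * s) (w * t) = h0 s t.
Proof.
rewrite /w; case: b; first by rewrite -!opI_mul !mul1r opI_iso.
by rewrite omegaE [LHS]std_form_blade_mul.
Qed.

Let rho_action : clifford_action (@rho_complex R m).
Proof. exact: (doubled_action complex_rhoE complex_tau complex_gen). Qed.

Let complex_schur (T : S -> S) : linear T -> (forall s, T (I s) = I (T s)) ->
  (forall i s, T (rho_complex (delta_mx i 0) s) = rho_complex (delta_mx i 0) (T s)) ->
  exists x y : R, forall s, T s = x *: s + y *: I s.
Proof.
move=> T_lin TI T_rho.
have [|a Ta] := doubled_schur complex_rhoE complex_tau m_even T_lin _ T_rho.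
  move=> a s; rewrite !cmulE' (linD T_lin) !(linZ T_lin) TI //.
by exists (complex.Re a), (complex.Im a) => s; rewrite Ta cmulE'.
Qed.

Let rho_l i s : rho_complex (delta_mx (lshift m i) 0) s = gen i * s.
Proof. exact: (doubled_lshift complex_rhoE). Qed.

Let rho_r i s : rho_complex (delta_mx (rshift m i) 0) s =
  if b then I (alpha s * gen i) else omega * s * gen i.
Proof.
rewrite (doubled_rshift complex_rhoE) /w; case: b => //.
by rewrite -!opI_mul mul1r.
Qed.

Let I_rho i s : I (rho_complex (delta_mx i 0) s) = rho_complex (delta_mx i 0) (I s).
Proof.
case: (split_ordP i) => j ->; first by rewrite !rho_l opI_mulr.
rewrite !rho_r; case: b; first by rewrite -opI_alpha opI_mul.
by rewrite opI_mul opI_mulr.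
Qed.

(** *** The structure map *)

Let conj : C -> C := @conjc R.

Let conjN x : conj (- x) = - conj x.
Proof. by case: x => a c; apply/eqP; rewrite eq_complex /= !eqxx. Qed.

Let opcE s : opc s = cmap conj s. Proof. by []. Qed.

Let opc_lin : linear (@opc R m).
Proof.
apply: cmap_linear => a [x y] [z u]; apply/eqP.
by rewrite eq_complex /= eqxx opprD mulrN eqxx.
Qed.

Let opcK s : opc (opc s) = s.
Proof.
apply: clifford_ext => B; rewrite !opcE !cmapE.
by case: (s B) => x y; rewrite /conj /= opprK.
Qed.

Let opc_I s : opc (I s) = - I (opc s).
Proof.
apply: clifford_ext => B; rewrite coefN !opcE !opIE !(cmapE, cmulE).
case: (s B) => x y; apply/eqP; rewrite eq_complex /=.
by apply/andP; split; apply/eqP; ring.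
Qed.

Let opc_gen i s : opc (gen i * s) = gen i * opc s. Proof. exact: cmap_blade. Qed.
Let opc_mul_gen i s : opc (s * gen i) = opc s * gen i.
Proof. exact: cmap_mul_blade. Qed.
Let opc_omega s : opc (omega * s) = omega * opc s. Proof. exact: cmap_omega. Qed.
Let opc_alpha s : opc (alpha s) = alpha (opc s). Proof. exact: cmap_alpha. Qed.

Let opc_iso s t : h0 (opc s) (opc t) = h0 s t.
Proof. by apply: std_form_cmap => -[x y] [z u]; rewrite /q /= mulrNN. Qed.

Let opJE s : J s = if b then omega * opc s else alpha (opc s).
Proof. by rewrite /opJ /b; case: eqP. Qed.

Let alphaN s : alpha (- s) = - alpha s. Proof. exact: (linN (@alpha_linear _ _ _)). Qed.

Let opJ_lin : linear J.
Proof.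
move=> a s t; rewrite !opJE opc_lin; case: b; first by rewrite mulrDr scalerAr.
exact: alpha_linear.
Qed.

Let opJ_I s : J (I s) = - I (J s).
Proof.
rewrite !opJE opc_I; case: b; first by rewrite mulrN opI_mulr.
by rewrite alphaN opI_alpha.
Qed.

Let opJ_iso s t : h0 (J s) (J t) = h0 s t.
Proof.
rewrite !opJE; case: b; first by rewrite omegaE [LHS]std_form_blade_mul // opc_iso.
by rewrite [LHS]std_form_alpha // opc_iso.
Qed.

Hypothesis m_neq3 : (m %% 4 <> 3)%N.

(* The square of omega is -1 for m = 1, 2, but 1 for m = 3 mod 4. *)
Let opJ_sq s : J (J s) = (-1) ^+ b *: s.
Proof.
have := odd_bin2 m; rewrite !opJE /b.
have := ltn_pmod m (isT : 0 < 4)%N; have := m_neq3.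
case: eqP => [->|] /=; first by rewrite opc_alpha alphaK opcK scale1r.
case: (m %% 4)%N => [|[|[|[]]]] //= _ _ _ odd_sq;
by rewrite opc_omega opcK mulrA omega_sqr -signr_odd odd_sq -scalerAl mul1r.
Qed.

Let opJ_rho i s : J (rho_complex (delta_mx i 0) s) =
  (-1) ^+ (~~ odd m) *: rho_complex (delta_mx i 0) (J s).
Proof.
have m0 := m_even; rewrite !opJE.
case: (split_ordP i) => j ->; rewrite ?rho_l ?rho_r;
  case: b m0 => [_|/(_ isT) m0]; rewrite ?m0.
- rewrite opc_gen !mulrA gen_omega -scalerAl scalerA -(signr_odd _ m.+1) /=.
  by rewrite -exprD addnn -signr_odd odd_double scale1r.
- by rewrite opc_gen alpha_gen scaleN1r.
- rewrite opc_I opc_mul_gen opc_alpha mulrN -opI_mulr mulrA alpha_omega.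
  rewrite -scalerAl (linZ opI_lin) scalerA -(signr_odd _ m) -exprD.
  by case: (odd m); rewrite scaleN1r.
- rewrite opc_mul_gen opc_omega alpha_mul_gen alpha_omega -signr_odd (negPf m0).
  by rewrite scale1r scaleN1r.
Qed.

(* If m = 0 mod 4, then [J] is 1 on [Splus] and -1 on [Sminus]. *)
Let Splus_fixed s : ~~ b -> Splus s -> J s = (-1) ^+ 0 *: s.
Proof.
move=> b0 s_plus; rewrite opJE (negPf b0) scale1r; apply: clifford_ext => B.
rewrite alphaE opcE cmapE -signr_odd; have := s_plus B.
case: (s B) => x y; case: (odd _) => /= ->; apply/eqP; rewrite eq_complex.
  by rewrite expr1 mulN1r /= oppr0 opprK !eqxx.
by rewrite mul1r /= oppr0 !eqxx.
Qed.

Let Sminus_negated s : ~~ b -> Sminus s -> J s = (-1) ^+ 1 *: s.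
Proof.
move=> b0 [t t_plus ->]; rewrite opJ_I (Splus_fixed b0 t_plus) scale1r.
by rewrite expr1 scaleN1r.
Qed.

Lemma complex_spin_embeddings (h : S -> S -> R) :
  scalar_product h -> clifford_invariant (@trho_complex R m) h ->
  let j (A : S -> S) := jrho (@trho_complex R m) (fun s t => h (A s) t) in
  let jId := j id in
  let jI := j I in
  let jJ := j J in
  let jK := j (@opK R m) in
  [/\ [/\ so_embedding (@trho_complex R m) jId,
          so_embedding (@trho_complex R m) jI,
          so_embedding (@trho_complex R m) jJ
        & so_embedding (@trho_complex R m) jK],
      forall phi, so_embedding (@trho_complex R m) phi ->
        exists a b c d : R, forall v s t,
          phi v s t =
            a * jId v s t + b * jI v s t + c * jJ v s t + d * jK v s t,
      (m %% 4 = 1)%N -> forall v,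
        [/\ form_skew (jId v), form_symmetric (jI v),
            form_symmetric (jJ v) & form_symmetric (jK v)],
      (m %% 4 = 2)%N -> forall v,
        [/\ form_skew (jId v), form_symmetric (jI v),
            form_skew (jJ v) & form_skew (jK v)]
    & (m %% 4 = 0)%N -> forall v,
        [/\ form_skew (jId v) /\ isotropic_halves (jId v),
            form_symmetric (jI v) /\ orthogonal_halves (jI v),
            form_symmetric (jJ v) /\ isotropic_halves (jJ v)
          & form_symmetric (jK v) /\ orthogonal_halves (jK v)]].
Proof.
move=> hP h_inv j jId jI jJ jK.
have odd_mod4 : odd m = odd (m %% 4) by rewrite odd_mod.
have N_even : ~~ odd (m + m) by rewrite addnn odd_double.
have d_odd : odd m -> odd b by apply: contraTT; rewrite oddb => /m_even.
have h0P : scalar_product h0 by apply: std_form_scalar_product.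
have repP := std_repP (m := m) repqP.
have rho_iso := doubled_isometry complex_rhoE qP w_iso.
have sym v : [/\ form_skew (jId v), form_symmetric (jI v),
    forall s t, jJ v s t = (-1) ^+ (b + ~~ odd m).+1 * jJ v t s
  & forall s t, jK v s t = (-1) ^+ (b + ~~ odd m).+1 * jK v t s].
  exact: (complex_symmetry N_even rho_action (odd_bin2_double m) d_odd
    opI_lin opJ_lin opI_sq opJ_sq opJ_I I_rho opJ_rho complex_schur
    (oner_neq0 S) h0P repP rho_iso opI_iso opJ_iso hP h_inv).
split.
- exact: (complex_embeddings N_even rho_action (odd_bin2_double m) d_odd
    opI_lin opJ_lin opI_sq opJ_sq opJ_I I_rho opJ_rho complex_schur
    (oner_neq0 S) h0P repP rho_iso opI_iso opJ_iso hP h_inv).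
- exact: (complex_embedding_span N_even rho_action (odd_bin2_double m) d_odd
    opI_lin opJ_lin opI_sq opJ_sq opJ_I I_rho opJ_rho complex_schur
    (oner_neq0 S) h0P repP rho_iso opI_iso opJ_iso hP h_inv).
- move=> m1 v; have [skew_Id sym_I sym_J sym_K] := sym v.
  have sign : (-1) ^+ (b + ~~ odd m).+1 = 1 :> R.
    by rewrite odd_mod4 /b m1 /= expr2 mulN1r opprK.
  by split=> // s t; rewrite ?(sym_J s) ?(sym_K s) sign mul1r.
- move=> m2 v; have [skew_Id sym_I sym_J sym_K] := sym v.
  have sign : (-1) ^+ (b + ~~ odd m).+1 = -1 :> R.
    by rewrite odd_mod4 /b m2 -signr_odd expr1.
  by split=> // s t; rewrite ?(sym_J s) ?(sym_K s) sign mulN1r.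
move=> m0 v; have [skew_Id sym_I sym_J sym_K] := sym v.
have b0 : ~~ b by rewrite /b m0.
have sign : (-1) ^+ (b + ~~ odd m).+1 = 1 :> R.
  by rewrite odd_mod4 /b m0 /= expr2 mulN1r opprK.
have halves x y s t : J s = (-1) ^+ x *: s -> J t = (-1) ^+ y *: t ->
    (~~ odd (x + y) -> jId v s t = 0 /\ jJ v s t = 0) /\
    (odd (x + y) -> jI v s t = 0 /\ jK v s t = 0).
  exact: (complex_eigenspaces N_even rho_action (odd_bin2_double m) d_odd
    opI_lin opJ_lin opI_sq opJ_sq opJ_I I_rho opJ_rho complex_schur
    (oner_neq0 S) h0P repP rho_iso opI_iso opJ_iso hP h_inv v (m_even b0)).
have plus s : Splus s -> J s = (-1) ^+ 0 *: s by exact: Splus_fixed.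
have minus s : Sminus s -> J s = (-1) ^+ 1 *: s by exact: Sminus_negated.
split; split=> //.
- by split=> s t; [move=> /plus Js /plus Jt | move=> /minus Js /minus Jt];
    have [/(_ isT)[]] := halves _ _ _ _ Js Jt.
- move=> s t /plus Js /minus Jt; split.
    by have [_ /(_ isT)[]] := halves _ _ _ _ Js Jt.
  by have [_ /(_ isT)[]] := halves _ _ _ _ Jt Js.
- by move=> s t; rewrite sym_J sign mul1r.
- by split=> s t; [move=> /plus Js /plus Jt | move=> /minus Js /minus Jt];
    have [/(_ isT)[]] := halves _ _ _ _ Js Jt.
- by move=> s t; rewrite sym_K sign mul1r.
- move=> s t /plus Js /minus Jt; split.
    by have [_ /(_ isT)[]] := halves _ _ _ _ Js Jt.
  by have [_ /(_ isT)[]] := halves _ _ _ _ Jt Js.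
Qed.

End ComplexSpinModule.

Theorem theorem4p12 (R : realType) (m : nat) :
  ((m %% 4 = 3)%N ->
    forall h : Cl R m -> Cl R m -> R,
    scalar_product h -> clifford_invariant (@trho_real R m) h ->
    [/\ so_embedding (@trho_real R m) (jrho (@trho_real R m) h),
        forall v, form_skew (jrho (@trho_real R m) h v)
      & forall phi, so_embedding (@trho_real R m) phi ->
          exists a : R, forall v s t,
            phi v s t = a * jrho (@trho_real R m) h v s t])
  /\
  ((m %% 4 <> 3)%N ->
    forall h : CCl R m -> CCl R m -> R,
    scalar_product h -> clifford_invariant (@trho_complex R m) h ->
    let j (A : CCl R m -> CCl R m) :=
      jrho (@trho_complex R m) (fun s t => h (A s) t) in
    let jId := j id in
    let jI := j (@opI R m) in
    let jJ := j (@opJ R m) in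
    let jK := j (@opK R m) in
    [/\ [/\ so_embedding (@trho_complex R m) jId,
            so_embedding (@trho_complex R m) jI,
            so_embedding (@trho_complex R m) jJ
          & so_embedding (@trho_complex R m) jK],
        forall phi, so_embedding (@trho_complex R m) phi ->
          exists a b c d : R, forall v s t,
            phi v s t =
              a * jId v s t + b * jI v s t + c * jJ v s t + d * jK v s t,
        (m %% 4 = 1)%N -> forall v,
          [/\ form_skew (jId v), form_symmetric (jI v),
              form_symmetric (jJ v) & form_symmetric (jK v)],
        (m %% 4 = 2)%N -> forall v,
          [/\ form_skew (jId v), form_symmetric (jI v),
              form_skew (jJ v) & form_skew (jK v)]
      & (m %% 4 = 0)%N -> forall v,
          [/\ form_skew (jId v) /\ isotropic_halves (jId v),
              form_symmetric (jI v) /\ orthogonal_halves (jI v),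
              form_symmetric (jJ v) /\ isotropic_halves (jJ v)
            & form_symmetric (jK v) /\ orthogonal_halves (jK v)]]).
Proof.
split=> m3 h; first exact: real_spin_embeddings.
exact: complex_spin_embeddings.
Qed.
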